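(* Assume that the Nicholson system $$y_i'(t)=-\tilde d_i(t)\,y_i(t)+\sum_{j=1}^m \tilde a_{ij}(t)\,y_j(t)+\tilde\beta_i(t)\,y_i(t-r_i)\,e^{-\tilde c_i(t)\,y_i(t-r_i)},\quad t\ge 0,\quad i=1,\ldots,m,$$ with delays $r_i>0$, satisfies assumptions (a1)--(a6) listed in the context and is uniformly persistent at $0$. Let $c_i^-:=\inf_{t\in\mathbb{R}}\tilde c_i(t)$ and $c_i^+:=\sup_{t\in\mathbb{R}}\tilde c_i(t)$ (positive constants). If, for every $t\in\mathbb{R}$, $$0<\frac{\tilde\beta_i(t)}{\tilde d_i(t)-\sum_{j\ne i}\tilde a_{ij}(t)\,\frac{c_i^+}{c_j^+}}\le e^{c_i^-/c_i^+}\quad\text{for each } i=1,\ldots,m,$$ then there exists a unique positive almost periodic solution of the Nicholson system which attracts every other positive solution at an exponential rate as $t\to\infty$; more precisely, it attracts at an exponential rate every other solution $y(t,\varphi)$ with initial value $\varphi\ge0$ such that $\varphi(0)\gg0$.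
   Context: Almost periodicity: a continuous function $h:\mathbb{R}\to\mathbb{R}$ is almost periodic if for every $\varepsilon>0$ the set $\{s\in\mathbb{R}: |h(t+s)-h(t)|<\varepsilon \text{ for all } t\in\mathbb{R}\}$ is relatively dense in $\mathbb{R}$ (and componentwise for $\mathbb{R}^m$-valued functions). Assumptions on the coefficients: (a1) $\tilde d_i,\tilde a_{ij},\tilde c_i,\tilde\beta_i$ are almost periodic functions on $\mathbb{R}$; (a2) there is a constant $d_0>0$ with $\tilde d_i(t)\ge d_0$ for each $t\in\mathbb{R}$ and $i\in\{1,\dots,m\}$; (a3) all $\tilde a_{ij}(t)$ are nonnegative functions and $\tilde a_{ii}$ is identically null; (a4) $\tilde\beta_i(t)>0$ for each $t\in\mathbb{R}$ and $i$; (a5) there is a constant $c_0>0$ with $\tilde c_i(t)\ge c_0$ for each $t\in\mathbb{R}$ and $i$; (a6) $\tilde d_i(t)-\sum_{j=1}^m\tilde a_{ji}(t)>0$ for each $t\in\mathbb{R}$ and $i$. State space: $X=C([-r_1,0])\times\cdots\times C([-r_m,0])$ (real-valued continuous functions) with the supremum norm $\|\cdot\|_\infty$. For $\varphi\in X$, $\varphi\ge0$ means $\varphi_i(s)\ge0$ for all $s\in[-r_i,0]$, $1\le i\le m$; for $v\in\mathbb{R}^m$, $v\gg0$ means all components are positive. For a continuous function $y$ and a time $t$, $y_t\in X$ is defined by $(y_t)_i(s)=y_i(t+s)$, $s\in[-r_i,0]$. $y(t,\varphi)$ denotes the solution of the Nicholson system with initial value $\varphi$ (i.e. $y_0=\varphi$),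 and $y_t(\varphi)$ its segment at time $t$; for $\varphi\ge0$ it is defined for all $t\ge0$ and remains nonnegative. Uniform persistence at $0$: the Nicholson system is uniformly persistent at $0$ if there exists $M>0$ such that for every $\varphi\ge0$ in $X$ with $\varphi(0)\gg0$ there exists a time $t_0=t_0(\varphi)$ such that $y_i(t,\varphi)\ge M$ for all $t\ge t_0$ and $i=1,\dots,m$. A positive almost periodic solution is an almost periodic function $p:\mathbb{R}\to\mathbb{R}^m$ with $p(t)\gg0$ for all $t$ which solves the system. That $p$ attracts $y(t,\varphi)$ at an exponential rate means that $\|y_t(\varphi)-p_t\|_\infty\to0$ exponentially fast as $t\to\infty$, i.e. there are constants $C,\delta>0$ (possibly depending on $\varphi$) with $\|y_t(\varphi)-p_t\|_\infty\le C e^{-\delta t}$ for all $t\ge0$. *)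

(* Defs.v *)
From HB Require Import structures.
From mathcomp Require Import all_boot all_order all_algebra.
From mathcomp Require Import all_classical all_reals all_analysis.
Set Implicit Arguments.
Unset Strict Implicit.
Unset Printing Implicit Defensive.
Import Order.TTheory GRing.Theory Num.Theory.
Import numFieldNormedType.Exports.
Local Open Scope classical_set_scope.
Local Open Scope ring_scope.

Definition relatively_dense (R : realType) (A : set R) : Prop :=
  exists2 l : R, 0 < l & forall x : R, exists2 s, A s & x <= s <= x + l.

Definition almost_periodic (R : realType) (h : R -> R) : Prop :=
  continuous h /\
  forall e : R, 0 < e ->
    relatively_dense [set s | forall t, `|h (t + s) - h t| < e].

(* Vector functions are curried: y i t is the i-th component at time t. *)
Record nicholson (R : realType) (m : nat) := Nicholson {
  delay : 'I_m -> R ;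
  dcoef : 'I_m -> R -> R ;
  acoef : 'I_m -> 'I_m -> R -> R ;
  ccoef : 'I_m -> R -> R ;
  bcoef : 'I_m -> R -> R }.

Section NicholsonSystem.
Variables (R : realType) (m : nat) (N : nicholson R m).
Implicit Types (phi y p : 'I_m -> R -> R) (i j : 'I_m) (s t : R).

Definition nicholson_rhs y i t : R :=
  - dcoef N i t * y i t + \sum_(j < m) acoef N i j t * y j t
  + bcoef N i t * y i (t - delay N i)
    * expR (- ccoef N i t * y i (t - delay N i)).

(* An element of the product of the C([-r_i, 0]) is represented by total
   functions; their values outside [-r_i, 0] are irrelevant. *)
Definition in_state_space phi : Prop :=
  forall i, {within `[- delay N i, 0], continuous (phi i)}.

Definition state_ge0 phi : Prop :=
  forall i s, - delay N i <= s <= 0 -> 0 <= phi i s.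

(* A genuine supremum on the state space, where the set is bounded. *)
Definition state_norm phi : R :=
  sup [set x | exists i, exists2 s, - delay N i <= s <= 0 & x = `|phi i s|].

Definition segment y t : 'I_m -> R -> R := fun i s => y i (t + s).

(* y is y(., phi). Only the values of y i on [-r_i, +oo[ matter; the
   derivative at time 0 is the right derivative. *)
Definition solution_from phi y : Prop :=
  [/\ forall i, {within `[- delay N i, +oo[, continuous (y i)},
      forall i s, - delay N i <= s <= 0 -> y i s = phi i s,
      forall i, h^-1 * (y i h - y i 0) @[h --> 0^'+] --> nicholson_rhs y i 0
    & forall i t, 0 < t -> is_derive t 1 (y i) (nicholson_rhs y i t)].

Definition uniformly_persistent : Prop :=
  exists2 M : R, 0 < M &
    forall phi y, in_state_space phi -> state_ge0 phi ->
      (forall i, 0 < phi i 0) -> solution_from phi y ->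
      exists2 t0 : R, 0 <= t0 & forall t i, t0 <= t -> M <= y i t.

(* Such a p is defined on the whole line, and solves the equations there. *)
Definition positive_ap_solution p : Prop :=
  [/\ forall i, almost_periodic (p i),
      forall i t, 0 < p i t
    & forall i t, is_derive t 1 (p i) (nicholson_rhs p i t)].

Definition attracts_exponentially p y : Prop :=
  exists C delta : R, [/\ 0 < C, 0 < delta &
    forall t, 0 <= t ->
      state_norm (fun i s => segment y t i s - segment p t i s)
        <= C * expR (- delta * t)].

Definition cinf i : R := inf (range (ccoef N i)).
Definition csup i : R := sup (range (ccoef N i)).

End NicholsonSystem.

(* Main.v *)
(* No hull of the coefficients is needed. In the variables [csup N i * y i] the
   hypothesis on [bcoef] drives every solution below any level above 1, so by
   persistence it ends up in a region [M <= y i], [csup N i * y i <= 7 / 4]. There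
   [u * exp (- c * u)] contracts the logarithm of [u], and comparing the largest
   log-ratio of two approximate solutions with a barrier shows that they merge
   exponentially, up to a multiple of the approximation error. A translate of a
   solution by a common almost period of the coefficients is an approximate
   solution, so along common almost periods [s n] tending to infinity the
   translates [y (t + s n)] of one solution converge, uniformly for [t] bounded
   below, to the almost periodic solution. *)
Require Import Defs.
From HB Require Import structures.
From mathcomp Require Import all_boot all_order all_algebra.
From mathcomp Require Import all_classical all_reals all_analysis.
From mathcomp Require Import ring lra.
Set Implicit Arguments.
Unset Strict Implicit.
Unset Printing Implicit Defensive.
Import Order.TTheory GRing.Theory Num.Theory.
Import numFieldNormedType.Exports.
Local Open Scope classical_set_scope.
Local Open Scope ring_scope.

(** * Derivatives and primitives *)

(** The level 1 comes from the hypothesis: with [u = csup N i * v] and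
    [g = cinf N i / csup N i <= 1], the feedback term is at most the net damping times
    [u * exp (g * (1 - u))], which is at most 1 for [u <= 1] and smaller than [u] beyond. Logarithms
    are compared because the damping rates, common to both solutions, cancel in [y' / y - w' / w],
    while at the largest ratio every coupling quotient has a favourable sign. The obstacle is the
    delay: at a contact with a decreasing barrier the delayed values may exceed the present one. A
    barrier falling slowly enough is larger by at most a factor [Q] one delay earlier, and a
    contraction factor [k] with [k * Q < 1] absorbs this. Keeping an error term in the merging
    estimate lets it serve three times: with error 0 for attraction and for uniqueness, with a small
    error for the recurrence of one solution. Persistence only speaks of given solutions, so at
    least one has to be constructed. *)

Lemma is_deriveP (R : realType) (f : R -> R) (t l : R) :
  is_derive t 1 f l <->
  forall e : R, 0 < e -> exists2 d : R, 0 < d &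
    forall h, `|h| < d -> `|f (t + h) - f t - h * l| <= e * `|h|.
Proof.
split.
  move=> fl e e0.
  have [df dl] : derivable f t 1 /\ 'D_1 f t = l by split; [exact: ex_derive|exact: derive_val].
  have /cvgrPdist_lt /(_ e e0) : h^-1 *: (f (h *: 1 + t) - f t) @[h --> 0^'] --> l.
    by rewrite -dl; exact: df.
  move=> [d /= d0 H]; exists d => // h hd.
  have [->|h0] := eqVneq h 0; first by rewrite addr0 mul0r subrr subrr normr0 mulr0.
  have /= := H h; rewrite /ball_ /= sub0r normrN => /(_ hd h0).
  rewrite /GRing.scale /= mulr1 [h + t]addrC => /ltW He.
  have -> : f (t + h) - f t - h * l = - (l - h^-1 * (f (t + h) - f t)) * h.
    by field.
  by rewrite normrM normrN ler_wpM2r.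
move=> H.
have C : h^-1 *: (f (h *: 1 + t) - f t) @[h --> 0^'] --> l.
  apply/cvgrPdist_lt => e e0; have [d d0 Hd] := H (e / 2) (divr_gt0 e0 (ltr0Sn _ 1)).
  exists d => //= h; rewrite /ball_ /= sub0r normrN => hd h0.
  rewrite /GRing.scale /= mulr1 [h + t]addrC.
  have -> : l - h^-1 * (f (t + h) - f t) = - h^-1 * (f (t + h) - f t - h * l).
    by field.
  rewrite normrM normrN normfV mulrC ltr_pdivrMr ?normr_gt0//.
  apply: le_lt_trans (Hd h hd) _; rewrite ltr_pM2r ?normr_gt0//; lra.
by apply: DeriveDef; [apply/cvg_ex; exists l|exact: cvg_lim].
Qed.

Lemma is_derive_continuous (R : realType) (f : R -> R) (t l : R) :
  is_derive t 1 f l -> {for t, continuous f}.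
Proof.
move=> fl; apply: differentiable_continuous.
by apply/derivable1_diffP; exact: ex_derive.
Qed.

Lemma continuousP_eps (R : realType) (f : R -> R) (t : R) :
  {for t, continuous f} <->
  forall e : R, 0 < e -> exists2 d : R, 0 < d &
    forall s, `|s - t| < d -> `|f s - f t| < e.
Proof.
split=> [/cvgrPdist_lt H e e0|H].
  have [d d0 Hd] := H e e0; exists d => // s sd; rewrite distrC; apply: Hd.
  by rewrite /ball_ /= distrC.
apply/cvgrPdist_lt => e e0; have [d d0 Hd] := H e e0.
by exists d => //= s; rewrite /ball_ /= distrC => sd; rewrite distrC; apply: Hd.
Qed.

Lemma derive_le_increment (R : realType) (f df : R -> R) (a b C : R) :
  a <= b -> (forall t, a <= t <= b -> is_derive t 1 f (df t)) ->
  (forall t, a <= t <= b -> df t <= C) -> f b - f a <= C * (b - a).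
Proof.
move=> ab H HC.
have [||c cab ->] := @MVT_segment R f df a b ab.
- by move=> x; rewrite in_itv/= => /andP[x1 x2]; apply: H; rewrite !ltW.
- apply: derivable_within_continuous => x; rewrite in_itv/= => xab.
  by have := H x xab => ?; exact: ex_derive.
- by apply: ler_wpM2r; [lra|apply: HC; move: cab; rewrite in_itv].
Qed.

Lemma derive_ge_increment (R : realType) (f df : R -> R) (a b C : R) :
  a <= b -> (forall t, a <= t <= b -> is_derive t 1 f (df t)) ->
  (forall t, a <= t <= b -> C <= df t) -> C * (b - a) <= f b - f a.
Proof.
move=> ab H HC.
have G : (- f) b - (- f) a <= - C * (b - a).
  apply: (@derive_le_increment R (- f) (- df)) => // t /[dup] tab.
    by move=> /H ?; exact: is_deriveN.
  by move=> /HC; rewrite !fctE lerN2.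
by move: G; rewrite !fctE; lra.
Qed.

Lemma derive_increment_dominated (R : realType) (f df g dg : R -> R) (a b : R) :
  a <= b -> (forall t, a <= t <= b -> is_derive t 1 f (df t)) ->
  (forall t, a <= t <= b -> is_derive t 1 g (dg t)) ->
  (forall t, a <= t <= b -> df t <= dg t) -> f b - f a <= g b - g a.
Proof.
move=> ab Hf Hg H.
have G : (f - g) b - (f - g) a <= 0 * (b - a).
  apply: (@derive_le_increment R (f - g) (df - dg)) => // t tab.
    by have := Hf t tab; have := Hg t tab => ? ?; exact: is_deriveB.
  by rewrite !fctE subr_le0; exact: H.
by move: G; rewrite !fctE; lra.
Qed.

Lemma derive_abs_increment (R : realType) (f df : R -> R) (a b C : R) :
  (forall t, `|t - a| <= `|b - a| -> is_derive t 1 f (df t)) ->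
  (forall t, `|t - a| <= `|b - a| -> `|df t| <= C) -> `|f b - f a| <= C * `|b - a|.
Proof.
move=> H HC; have [ab|ba] := leP a b.
  have nb : `|b - a| = b - a by rewrite ger0_norm// subr_ge0.
  have B t : a <= t <= b -> `|t - a| <= `|b - a|.
    by move=> /andP[at_ tb]; rewrite nb ger0_norm; lra.
  rewrite nb ler_norml -mulNr; apply/andP; split.
    apply: derive_ge_increment => // t /B; first exact: H.
    by move=> /HC; rewrite ler_norml => /andP[].
  apply: derive_le_increment => // t /B; first exact: H.
  by move=> /HC; rewrite ler_norml => /andP[].
have nb : `|b - a| = a - b by rewrite distrC ger0_norm// subr_ge0 ltW.
have B t : b <= t <= a -> `|t - a| <= `|b - a|.
  by move=> /andP[at_ tb]; rewrite nb distrC ger0_norm; lra.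
rewrite distrC nb ler_norml -mulNr; apply/andP; split.
  apply: derive_ge_increment => [|t /B|t /B]; [exact: ltW|exact: H|].
  by move=> /HC; rewrite ler_norml => /andP[].
apply: derive_le_increment => [|t /B|t /B]; [exact: ltW|exact: H|].
by move=> /HC; rewrite ler_norml => /andP[].
Qed.

(** The integral from [- n] is a primitive only to the right of [- n]. Its increment from 0 does not
    depend on [n], so these increments glue to a primitive on the whole line. *)
Lemma primitive_exists (R : realType) (g : R -> R) : continuous g ->
  exists G : R -> R, G 0 = 0 /\ forall t : R, is_derive t 1 G (g t).
Proof.
move=> cg.
pose I (n : nat) (x : R) := (\int[lebesgue_measure]_(t in `[- n%:R, x]) g t)%R.
have int (a b : R) : lebesgue_measure.-integrable `[a, b] (EFin \o g).
  apply: continuous_compact_integrable; first exact: segment_compact.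
  exact: continuous_subspaceT.
have dI n (x : R) : - n%:R < x -> is_derive x 1 (I n) (g x).
  move=> nx; have [] := @continuous_FTC1_closed R g (- n%:R) x (x + 1) _ _ nx _.
  - by rewrite ltrDl.
  - exact: int.
  - exact: cg.
  by move=> ? <-; rewrite derive1E; exact: derivableP.
(* The margin 1 lets the base point [- N t] also serve every point at distance less than 1 from
   [t]. *)
have [N HN] : exists N : R -> nat, forall x : R, `|x| + 1 < (N x)%:R.
  have /choice [N HN] (x : R) : exists n : nat, `|x| + 1 < n%:R.
    by exists (Num.truncn (`|x| + 1)).+1; rewrite truncnS_gt.
  by exists N.
have Iind n k (x : R) : 0 < n%:R :> R -> 0 < k%:R :> R -> - n%:R < x -> - k%:R < x ->
   I n x - I n 0 = I k x - I k 0.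
  move=> n0 k0 nx kx.
  have D (y : R) : - n%:R < y -> - k%:R < y -> is_derive y 1 (I n - I k) 0.
    move=> ny ky; have := dI n y ny; have := dI k y ky => ? ?.
    by rewrite -[X in is_derive _ _ _ X](subrr (g y)); exact: is_deriveB.
  have : `|(I n - I k) x - (I n - I k) 0| <= 0 * `|x - 0|.
    have [x0|x0] := leP 0 x.
      have J (t : R) : 0 <= t <= x -> is_derive t 1 (I n - I k) 0.
        by move=> /andP[t0 _]; apply: D; lra.
      have A := @derive_le_increment R (I n - I k) (fun=> 0) 0 x 0 x0 J (fun _ _ => lexx _).
      have B := @derive_ge_increment R (I n - I k) (fun=> 0) 0 x 0 x0 J (fun _ _ => lexx _).
      by rewrite mul0r normr_le0; move: A B; rewrite !mul0r => A B; apply/eqP; lra.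
    have J (t : R) : x <= t <= 0 -> is_derive t 1 (I n - I k) 0.
      by move=> /andP[t0 _]; apply: D; lra.
    have A := @derive_le_increment R (I n - I k) (fun=> 0) x 0 0 (ltW x0) J (fun _ _ => lexx _).
    have B := @derive_ge_increment R (I n - I k) (fun=> 0) x 0 0 (ltW x0) J (fun _ _ => lexx _).
    by rewrite mul0r normr_le0; move: A B; rewrite !mul0r => A B; apply/eqP; lra.
  rewrite mul0r normr_le0 !fctE => /eqP; lra.
exists (fun x => I (N x) x - I (N x) 0); split; first by rewrite subrr.
move=> t.
have Nt0 : 0 < (N t)%:R :> R by have := HN t; have := normr_ge0 t; lra.
have Dt : is_derive t 1 (I (N t) - cst (I (N t) 0)) (g t).
  rewrite -[X in is_derive _ _ _ X]subr0.
  have := dI (N t) t _ => /(_ _)[|? ?].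
    by have := HN t; have := ler_norm (- t); rewrite normrN; lra.
  by apply: is_deriveB; exact: DeriveDef.
apply: near_eq_is_derive Dt.
exists 1 => //= s; rewrite /ball_ /= => ts; rewrite !fctE.
have := HN s; have := HN t; have := ler_norm (- t); have := ler_norm (- s).
have := normr_ge0 s; have := ler_norm (t - s); rewrite !normrN => *.
by apply: Iind; lra.
Qed.

Lemma continuous_sum (R : realType) (I : Type) (s : seq I) (f : I -> R -> R) (t : R) :
  (forall i, {for t, continuous (f i)}) ->
  {for t, continuous (fun u => \sum_(i <- s) f i u)}.
Proof.
move=> cf; suff : \sum_(i <- s) f i u @[u --> t] --> \sum_(i <- s) f i t by [].
elim: s => [|i s IH].
  by under eq_fun do rewrite big_nil; rewrite big_nil; exact: cvg_cst.
under eq_fun do rewrite big_cons; rewrite big_cons.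
by apply: cvgD; [exact: cf|exact: IH].
Qed.

Lemma is_derive_translate (R : realType) (f : R -> R) (c t l : R) :
  is_derive (t + c) 1 f l -> is_derive t 1 (fun u => f (u + c)) l.
Proof.
move=> /is_deriveP D; apply/is_deriveP => e e0; have [d d0 Hd] := D e e0.
by exists d => // h hd; rewrite (addrAC t h c); exact: Hd.
Qed.

Lemma is_derive_at_right (R : realType) (f : R -> R) (t l : R) :
  is_derive t 1 f l -> h^-1 * (f (t + h) - f t) @[h --> 0^'+] --> l.
Proof.
move=> /is_deriveP D; apply/cvgrPdist_lt => e e0.
have [d d0 Hd] := D (e / 2) (divr_gt0 e0 (ltr0Sn _ 1)).
near=> h.
have h0 : 0 < h by near: h; exact: nbhs_right_gt.
have hd : `|h| < d by rewrite gtr0_norm//; near: h; exact: nbhs_right_lt.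
have -> : l - h^-1 * (f (t + h) - f t) = - h^-1 * (f (t + h) - f t - h * l).
  by field; rewrite gt_eqF.
rewrite normrM normrN normfV mulrC ltr_pdivrMr ?normr_gt0 ?gt_eqF//.
apply: le_lt_trans (Hd h hd) _; rewrite ltr_pM2r ?normr_gt0 ?gt_eqF//; lra.
Unshelve. all: by end_near. Qed.

Lemma dist_max0_le (R : realType) (u v : R) :
  `|Num.max u 0 - Num.max v 0| <= `|u - v|.
Proof.
wlog uv : u v / u <= v => [H|].
  have [uv|/ltW vu] := leP u v; first exact: H.
  by rewrite distrC [leRHS]distrC; exact: H.
have uv0 : Num.max u 0 <= Num.max v 0 by rewrite ge_max !le_max uv lexx orbT.
rewrite ler0_norm ?subr_le0// ler0_norm ?subr_le0//.
by case: (leP u 0) uv0; case: (leP v 0) => *; lra.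
Qed.

Lemma continuous_compose_max0 (R : realType) (f : R -> R) :
  continuous f -> continuous (fun s : R => f (Num.max s 0)).
Proof.
move=> cf t; apply/continuousP_eps => e e0.
have /continuousP_eps /(_ e e0) [d d0 Hd] := cf (Num.max t 0).
by exists d => // s sd; apply: Hd; exact: le_lt_trans (dist_max0_le _ _) sd.
Qed.

(** * Almost periodic functions *)

Definition almost_period (R : realType) (K : Type) (h : K -> R -> R) (e : R) : set R :=
  [set s | forall k t, `|h k (t + s) - h k t| < e].

Lemma within_continuous_bounded (R : realType) (f : R -> R) (a b : R) :
  {within `[a, b], continuous f} ->
  exists2 B : R, 0 < B & forall t, a <= t <= b -> `|f t| <= B.
Proof.
move=> cf; have [ab|ba] := leP a b; last by exists 1 => // t; lra.
have [c _ Hc] := EVT_max ab cf; have [d _ Hd] := EVT_min ab cf.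
exists (1 + `|f c| + `|f d|) => [|t tab].
  by have := normr_ge0 (f c); have := normr_ge0 (f d); lra.
have := Hc t; have := Hd t; rewrite !in_itv/= tab => /(_ isT) h1 /(_ isT) h2.
have := normr_ge0 (f c); have := normr_ge0 (f d).
have := ler_norm (f c); have := ler_norm (- f d); rewrite normrN => *.
by rewrite ler_norml; apply/andP; split; lra.
Qed.

(** Heine's theorem with only [t] confined to the segment: [t + u] may leave it. *)
Lemma segment_uniform_continuity (R : realType) (f : R -> R) (a b e : R) :
  continuous f -> 0 < e -> exists2 d : R, 0 < d &
    forall t u, a <= t <= b -> `|u| < d -> `|f (t + u) - f t| < e.
Proof.
move=> cf e0.
have /compact_near_coveringP := @segment_compact R a b.
move=> /(_ _ (0^'+) (fun d t => forall u, `|u| < d -> `|f (t + u) - f t| < e)).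
move=> [|d /= d0 H].
- move=> x _; have /continuousP_eps /(_ (e / 2)) := cf x.
  move=> /(_ (divr_gt0 e0 (ltr0Sn _ 1))) [d d0 Hd].
  exists (ball x (d / 2), [set y | y < d / 2]) => /=.
    split; first by apply: nbhsx_ballx; exact: divr_gt0.
    by apply: nbhs_right_lt; exact: divr_gt0.
  move=> [y c] /= [xy cd] u uc; rewrite /ball/= in xy.
  have yx : `|y - x| < d by rewrite distrC; lra.
  have yux : `|y + u - x| < d.
    have -> : y + u - x = (y - x) + u by ring.
    by apply: le_lt_trans (ler_normD _ _) _; rewrite [`|y - x|]distrC; lra.
  have -> : f (y + u) - f y = (f (y + u) - f x) - (f y - f x) by ring.
  apply: le_lt_trans (ler_normB _ _) _.
  by have := Hd _ yx; have := Hd _ yux; lra.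
exists (d / 2); first exact: divr_gt0.
move=> t u tab ud.
apply: (H (d / 2) _ _ t) => //=.
  by rewrite sub0r normrN gtr0_norm; lra.
by lra.
Qed.

Section AlmostPeriodic.
Variable R : realType.
Implicit Types (h : R -> R) (e : R).

(** An almost period brings any [t] into the compact [[0, l]] at the cost of 1. *)
Lemma almost_periodic_bounded h : almost_periodic h ->
  exists2 B : R, 0 < B & forall t, `|h t| <= B.
Proof.
move=> [ch /(_ 1 ltr01) [l l0 Hl]].
have [B B0 HB] := @within_continuous_bounded R h 0 l (continuous_subspaceT ch).
exists (B + 1) => [|t]; first lra.
have [s /= /(_ t) hs ts] := Hl (- t).
have hB : `|h (t + s)| <= B by apply: HB; lra.
have -> : h t = h (t + s) - (h (t + s) - h t) by ring.
by move=> *; apply: le_trans (ler_normB _ _) _; lra.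
Qed.

(** The same almost period moves [t] into [[0, l]] and is applied at [t] and at [t + u]: two errors
    [e / 3], and a third from uniform continuity on the segment. *)
Lemma almost_periodic_uniform_continuity h e : almost_periodic h -> 0 < e ->
  exists2 d : R, 0 < d & forall t u, `|u| < d -> `|h (t + u) - h t| < e.
Proof.
move=> [ch ap] e0; have e30 : 0 < e / 3 by exact: divr_gt0.
have [l l0 Hl] := ap _ e30.
have [d d0 Hd] := @segment_uniform_continuity R h 0 l (e / 3) ch e30.
exists d => // t u ud.
have [s /= hs ts] := Hl (- t).
have hd : `|h (t + s + u) - h (t + s)| < e / 3 by apply: Hd => //; lra.
have := hs t; have := hs (t + u).
have -> : h (t + u) - h t = (h (t + s + u) - h (t + s))
  - (h (t + u + s) - h (t + u)) + (h (t + s) - h t).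
  by rewrite [t + s + u]addrAC; ring.
move=> *; apply: le_lt_trans (ler_normD _ _) _.
by have := ler_normB (h (t + s + u) - h (t + s)) (h (t + u + s) - h (t + u)); lra.
Qed.

(* The differences of nearby almost periods of the two functions take finitely
   many values up to [d], and two pairs with the same value have a common
   difference. *)
Lemma relatively_denseI_almost_period (T : R -> set R) h :
  almost_periodic h ->
  (forall e, 0 < e -> relatively_dense (T e)) ->
  (forall e s u, T e s -> T e u -> T (e + e) (s - u)) ->
  forall e, 0 < e ->
  relatively_dense [set s | T e s /\ forall t, `|h (t + s) - h t| < e].
Proof.
move=> aph dT subT e e0; have [_ ap] := aph.
have e20 : 0 < e / 2 by exact: divr_gt0.
have e30 : 0 < e / 3 by exact: divr_gt0.
have [d d0 Hd] := almost_periodic_uniform_continuity aph e30.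
have [l1 l10 /(_ _)/cid2 H1] := dT _ e20.
have [l2 l20 /(_ _)/cid2 H2] := ap _ e30.
pose tau x := sval (H1 x); pose sig x := sval (H2 x).
have tauP x : T (e / 2) (tau x) /\ x <= tau x <= x + l1.
  by rewrite /tau; case: (H1 x).
have sigP x : (forall t, `|h (t + sig x) - h t| < e / 3) /\ x <= sig x <= x + l2.
  by rewrite /sig; case: (H2 x).
(* The differences [tau x - sig x] are sorted into cells of width [d]; adding [l2] makes them
   nonnegative. *)
pose q x := Num.truncn ((tau x - sig x + l2) / d).
have q0 x : 0 <= (tau x - sig x + l2) / d.
  by apply: divr_ge0; [case: (tauP x) (sigP x) => ? ? [? ?]; lra|exact: ltW].
pose J := Num.truncn ((l1 + l2) / d).
have qJ x : (q x < J.+1)%N.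
  rewrite ltnS; apply: le_truncn; rewrite ler_pM2r ?invr_gt0//.
  by case: (tauP x) (sigP x) => ? ? [? ?]; lra.
have /choice [rep repP] (j : 'I_J.+1) : exists y : R, (exists x, q x = j) -> q y = j.
  have [[x xj]|nx] := pselect (exists x, q x = j); first by exists x.
  by exists 0.
pose L := \sum_(j < J.+1) `|tau (rep j)|.
have LP j : `|tau (rep j)| <= L.
  by rewrite /L (bigD1 j)//= lerDl; apply: sumr_ge0.
have L0 : 0 <= L by apply: sumr_ge0.
(* The common almost period is [tau (x + L) - tau y] with [|tau y| <= L], so it lies between [x] and
   [x + l1 + 2 * L]. *)
exists (l1 + L + L) => [|x]; first lra.
pose y := rep (Ordinal (qJ (x + L))).
have qy : q y = q (x + L).
  by rewrite /y; apply: (repP (Ordinal (qJ (x + L)))); exists (x + L).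
have Ly : `|tau y| <= L by exact: LP.
exists (tau (x + L) - tau y); last first.
  case: (tauP (x + L)) => _; move: Ly; rewrite ler_norml => /andP[? ?] /andP[? ?].
  by apply/andP; split; lra.
split.
  rewrite [e]splitr; apply: subT; first by case: (tauP (x + L)).
  by case: (tauP y).
move=> t.
have := truncn_itv (q0 y); have := truncn_itv (q0 (x + L)).
rewrite -/(q _) -/(q _) qy => /andP[a1 a2] /andP[b1 b2].
set n := (q (x + L))%:R in a1 a2 b1 b2.
have n1 : (q (x + L)).+1%:R = n + 1 :> R by rewrite -natr1.
rewrite n1 in a2 b2.
rewrite ler_pdivlMr// in a1; rewrite ler_pdivlMr// in b1.
rewrite ltr_pdivrMr// in a2; rewrite ltr_pdivrMr// in b2.
rewrite mulrDl mul1r in a2; rewrite mulrDl mul1r in b2.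
(* Both differences lie in one cell. Hence moving [h] by the [tau] difference instead of the [sig]
   difference costs [e / 3], and the [sig] difference, made of two [e / 3]-almost periods, costs the
   rest. *)
have close : `|(tau (x + L) - tau y) - (sig (x + L) - sig y)| < d.
  by rewrite ltr_norml; apply/andP; split; lra.
have := Hd (t + (sig (x + L) - sig y)) _ close.
have -> : t + (sig (x + L) - sig y) + (tau (x + L) - tau y - (sig (x + L) - sig y))
  = t + (tau (x + L) - tau y) by ring.
have [s1 _] := sigP (x + L); have [s2 _] := sigP y.
have := s1 (t - sig y); have := s2 (t - sig y).
have -> : t - sig y + sig y = t by ring.
have -> : t - sig y + sig (x + L) = t + (sig (x + L) - sig y) by ring.
set A := h (t + (sig (x + L) - sig y)); set B := h (t - sig y).
set C := h (t + (tau (x + L) - tau y)) => u1 u2 u3.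
have -> : C - h t = (C - A) + ((A - B) - (h t - B)) by ring.
apply: le_lt_trans (ler_normD _ _) _.
by have := ler_normB (A - B) (h t - B); lra.
Qed.

Lemma almost_periodB (K : Type) (h : K -> R -> R) (a b s u : R) :
  almost_period h a s -> almost_period h b u -> almost_period h (a + b) (s - u).
Proof.
move=> hs hu k t; have := hs k (t - u); have := hu k (t - u).
rewrite subrK [t - u + s]addrAC -addrA => h1 h2.
have -> : h k (t + (s - u)) - h k t
  = (h k (t + (s - u)) - h k (t - u)) - (h k t - h k (t - u)) by ring.
by apply: le_lt_trans (ler_normB _ _) _; lra.
Qed.

Lemma almost_periodW (K : Type) (h : K -> R -> R) (a b s : R) :
  a <= b -> almost_period h a s -> almost_period h b s.
Proof. by move=> ab hs k t; exact: lt_le_trans (hs k t) ab. Qed.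

Lemma almost_periodN (K : Type) (h : K -> R -> R) (e s : R) :
  almost_period h e s -> almost_period h e (- s).
Proof. by move=> hs k t; have := hs k (t - s); rewrite subrK distrC. Qed.

Lemma common_almost_periods (K : finType) (h : K -> R -> R) :
  (forall k, almost_periodic (h k)) ->
  forall e, 0 < e -> relatively_dense (almost_period h e).
Proof.
move=> aph.
suff H (s : seq K) : forall e, 0 < e ->
    relatively_dense (almost_period (fun k : {k | k \in s} => h (val k)) e).
  move=> e e0; have [l l0 Hl] := H (enum K) e e0; exists l => // x.
  have [u hu xu] := Hl x; exists u => // k t.
  have ks : k \in enum K by rewrite mem_enum.
  exact: (hu (exist _ k ks) t).
elim: s => [|k s IH] e e0.
  by exists 1 => // x; exists x; [case|rewrite lexx lerDl ler01].
pose T e := almost_period (fun k : {k | k \in s} => h (val k)) e.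
have [|l l0 Hl] := @relatively_denseI_almost_period T (h k) (aph k) IH _ e e0.
  by move=> e' u v; exact: almost_periodB.
exists l => // x; have [u [hu hk] xu] := Hl x; exists u => // -[j js] t /=.
have [->|jk] := eqVneq j k; first exact: hk.
have js' : j \in s by move: (js); rewrite inE (negPf jk).
exact: (hu (exist _ j js') t).
Qed.

Lemma almost_period_near0 (K : finType) (h : K -> R -> R) (e : R) :
  (forall k, almost_periodic (h k)) -> 0 < e ->
  exists2 d, 0 < d & forall u, `|u| < d -> almost_period h e u.
Proof.
move=> aph e0.
have /choice [d dP] k : exists d, 0 < d /\
    forall t u, `|u| < d -> `|h k (t + u) - h k t| < e.
  by have [d d0 Hd] := almost_periodic_uniform_continuity (aph k) e0; exists d.
(* The inverse of a sum of inverses is a positive number below every [d k]; the term 1 covers an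
   empty index type. *)
pose D := 1 + \sum_k (d k)^-1.
have S0 : 0 <= \sum_k (d k)^-1.
  by apply: sumr_ge0 => k _; rewrite invr_ge0 ltW//; case: (dP k).
exists D^-1 => [|u uD k t]; first by rewrite invr_gt0 /D; lra.
have [dk0 Hk] := dP k; apply: Hk; apply: lt_le_trans uD _.
rewrite -[leRHS]invrK lef_pV2 ?posrE ?invr_gt0//; last by rewrite /D; lra.
rewrite /D (bigD1 k)//=.
have : 0 <= \sum_(i | i != k) (d i)^-1.
  by apply: sumr_ge0 => j _; rewrite invr_ge0 ltW//; case: (dP j).
lra.
Qed.

Lemma almost_periodic_family_bounded (K : finType) (h : K -> R -> R) :
  (forall k, almost_periodic (h k)) ->
  exists2 B, 0 < B & forall k t, `|h k t| <= B.
Proof.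
move=> aph.
have /choice [b bP] k : exists b, 0 < b /\ forall t, `|h k t| <= b.
  by have [b b0 Hb] := almost_periodic_bounded (aph k); exists b.
have b0 k : 0 <= b k by case: (bP k) => /ltW.
exists (1 + \sum_k b k) => [|k t].
  by have : 0 <= \sum_k b k; [apply: sumr_ge0|lra].
have [_ Hk] := bP k; apply: le_trans (Hk t) _.
rewrite (bigD1 k)//=; have : 0 <= \sum_(i | i != k) b i by apply: sumr_ge0.
lra.
Qed.

End AlmostPeriodic.

(** The limit inherits every Cauchy bound with the same [e] and [n0]. Limits chosen point by point
    are therefore uniform wherever the Cauchy bounds are. *)
Lemma cauchy_limit (R : realType) (u : nat -> R) :
  (forall e, 0 < e -> exists n0, forall n k, (n0 <= n)%N -> (n0 <= k)%N ->
    `|u n - u k| <= e) ->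
  exists l, forall e n0, (forall n k, (n0 <= n)%N -> (n0 <= k)%N ->
    `|u n - u k| <= e) -> forall n, (n0 <= n)%N -> `|u n - l| <= e.
Proof.
move=> H.
have cu : cvg (u @ \oo).
  apply/cauchy_cvgP/cauchy_exP => e e0.
  have [n0 Hn0] := H (e / 2) (divr_gt0 e0 (ltr0Sn _ 1)).
  exists (u n0); exists n0 => // n /= nn0; rewrite /ball /=.
  by apply: le_lt_trans (Hn0 n0 n (leqnn _) nn0) _; lra.
exists (lim (u @ \oo)) => e n0 He n nn0.
have cv : `|u n - u k| @[k --> \oo] --> `|u n - lim (u @ \oo)|.
  by apply: cvg_norm; apply: cvgB => //; exact: cvg_cst.
apply: (cvgr_to_le cv).
by exists n0 => // k /=; exact: He.
Qed.

(** * Barriers measured by a clock *)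

(** At the infimum of the times where some component reaches the barrier, all past values lie below
    it and one component touches it; the strict slope inequality would put that component above the
    barrier just before. Slopes need to be compared only under a bound on the whole past, which
    suits delay equations. *)
Lemma first_contact (R : realType) (I : finType) (x dx : I -> R -> R)
    (E dE : R -> R) (t0 : R) :
  (forall i t, t0 <= t -> is_derive t 1 (x i) (dx i t)) ->
  (forall t, t0 <= t -> is_derive t 1 E (dE t)) ->
  (forall i, x i t0 < E t0) ->
  (forall i t, t0 < t -> (forall j s, t0 <= s <= t -> x j s <= E s) ->
    x i t = E t -> dx i t < dE t) ->
  forall i t, t0 <= t -> x i t < E t.
Proof.
move=> dxP dEP x0 contact i1 t1 t01; rewrite ltNge; apply/negP => bad.
have cD i t : t0 <= t -> {for t, continuous (x i - E)}.
  move=> t0t; have := dxP i t t0t; have := dEP t t0t => ? ?.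
  by apply: is_derive_continuous; exact: is_deriveB.
pose A := [set t | t0 <= t /\ exists i, E t <= x i t].
have A1 : A t1 by split => //; exists i1.
have lbA : lbound A t0 by move=> t [].
have infA : has_inf A by split; [exists t1|exists t0].
set tau := inf A.
have t0tau : t0 <= tau by apply: lb_le_inf => //; exists t1.
have before i t : t0 <= t -> t < tau -> x i t < E t.
  move=> t0t ttau; rewrite ltNge; apply/negP => Ex.
  have : tau <= t by apply: ge_inf; [exists t0|split => //; exists i].
  by rewrite leNgt ttau.
have le_tau i : x i tau <= E tau.
  move: t0tau; rewrite le_eqVlt => /predU1P[<-|t0tau]; first exact: ltW.
  rewrite leNgt; apply/negP => Ex.
  have /continuousP_eps /(_ (x i tau - E tau)) := cD i tau (ltW t0tau).
  rewrite subr_gt0 => /(_ Ex) [d d0 Hd].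
  pose s := Num.max t0 (tau - d / 2).
  have s1 : t0 <= s by rewrite /s le_max lexx.
  have s2 : tau - d / 2 <= s by rewrite /s le_max lexx orbT.
  have s3 : s < tau by rewrite /s gt_max t0tau; lra.
  have := Hd s; rewrite !fctE => /(_ _)/wrap[|].
    by rewrite distrC ger0_norm; lra.
  by rewrite ltr_norml => /andP[? _]; have := before i s s1 s3; lra.
(* Finiteness of [I] enters here: if all components were strictly below at [tau], they would stay so
   on a common neighbourhood, against the choice of the infimum. *)
have [i Ei] : exists i, x i tau = E tau.
  apply: contrapT => /forallNP noE.
  have lt_tau i : x i tau < E tau by rewrite lt_neqAle le_tau andbT; apply/eqP/noE.
  have : \forall t \near tau, forall i, (x i - E) t < 0.
    apply: (@filter_forall _ I (fun i t => (x i - E) t < 0) (nbhs tau) _) => i.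
    have /cvgr_lt := cD i tau t0tau; apply.
    by rewrite !fctE subr_lt0.
  move=> [d /= d0 Hd].
  have [a [t0a [i Ea]] ad] := inf_adherent d0 infA.
  have taua : tau <= a by apply: ge_inf; [exists t0|split => //; exists i].
  have := Hd a; rewrite /ball_ /= => /(_ _)/wrap[|/(_ i)].
    by rewrite distrC ger0_norm; move: ad; rewrite -/tau; lra.
  by rewrite !fctE; lra.
have {}t0tau : t0 < tau.
  rewrite lt_neqAle t0tau andbT; apply/eqP => t0tauE.
  by have := x0 i; rewrite t0tauE Ei ltxx.
have dlt : dx i tau < dE tau.
  apply: contact => // j s /andP[s1]; rewrite le_eqVlt => /predU1P[->//|s2].
  by rewrite ltW// before.
have : is_derive tau 1 (x i - E) (dx i tau - dE tau).
  by have := dxP i tau (ltW t0tau); have := dEP tau (ltW t0tau) => ? ?; exact: is_deriveB.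
move=> /is_deriveP /(_ ((dE tau - dx i tau) / 2)) [|d d0 Hd]; first lra.
pose h := Num.min (d / 2) (tau - t0).
have h0 : 0 < h by rewrite lt_min; lra.
have hd : h <= d / 2 by rewrite ge_min lexx.
have ht : h <= tau - t0 by rewrite ge_min lexx orbT.
have := Hd (- h); rewrite normrN gtr0_norm// !fctE => /(_ _)/wrap[|]; first lra.
rewrite ler_norml => /andP[H _].
have {before} := before i (tau - h) => /(_ _ _)/wrap[||]; [lra..|].
rewrite Ei subrr subr0 in H.
have : 0 < h * ((dE tau - dx i tau) / 2) by apply: mulr_gt0; lra.
lra.
Qed.

(** [W] is the reading of a clock that never runs faster than real time and whose mean speed over
    long spans is at least [c], with [C] the constant it may lag behind. *)
Definition clock (R : realType) (w W : R -> R) (c C : R) : Prop :=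
  [/\ 0 < c, forall t, 0 < w t <= 1, forall t : R, is_derive t 1 W (w t)
    & forall s t, s <= t -> c * (t - s) - C <= W t - W s].

(* The coefficients are positive but may have infimum 0, so the decay has to be
   measured in the time [W] elapsed on a clock running at rate [w]. *)
Lemma clock_exists (R : realType) (K I : finType) (h : K -> R -> R) (f : I -> K) :
  (forall k, almost_periodic (h k)) ->
  (forall i t, 0 < h (f i) t) ->
  exists w W c C, @clock R w W c C /\ forall i t, w t <= h (f i) t.
Proof.
move=> aph h0.
(* Taking inverses of sums gives a continuous rate below 1 and below each [h (f i)]. *)
pose S t := 1 + \sum_i (h (f i) t)^-1.
pose w t := (S t)^-1.
have S0 t : 0 <= \sum_i (h (f i) t)^-1.
  by apply: sumr_ge0 => i _; rewrite invr_ge0 ltW.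
have S1 t : 1 <= S t by rewrite /S lerDl.
have w01 t : 0 < w t <= 1.
  by rewrite invr_gt0 invf_le1 ?S1 ?andbT; apply: lt_le_trans (S1 t).
have wh i t : w t <= h (f i) t.
  rewrite -[leRHS]invrK lef_pV2 ?posrE ?invr_gt0//; last exact: lt_le_trans (S1 t).
  rewrite /S (bigD1 i)//=.
  have : 0 <= \sum_(j | j != i) (h (f j) t)^-1.
    by apply: sumr_ge0 => j _; rewrite invr_ge0 ltW.
  lra.
have cw : continuous w.
  move=> t; apply: cvgV; first by rewrite gt_eqF// (lt_le_trans _ (S1 t)).
  apply: cvgD; first exact: cvg_cst.
  apply: continuous_sum => i; apply: cvgV; first by rewrite gt_eqF.
  by case: (aph (f i)) => ch _; exact: ch.
have [W [W0 dW]] := primitive_exists cw.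
have Wmono s t : s <= t -> W s <= W t.
  move=> st; have := @derive_ge_increment R W w s t 0 st (fun t _ => dW t).
  by rewrite mul0r subr_ge0; apply => u _; case/andP: (w01 u) => /ltW.
pose b := w 0; have b0 : 0 < b by case/andP: (w01 0).
have b40 : 0 < b / 4 by exact: divr_gt0.
have [l l0 Hl] := common_almost_periods aph b40.
have [d d0 Hd] := almost_period_near0 aph b40.
pose n := #|I|%:R : R.
have n0 : 0 <= n by exact: ler0n.
(* Each [h (f i) 0] is at least [b]. After an almost period and a small displacement, each costing
   [b / 4], at least [b / 2] remains, so [w >= v] there. Such places recur within every length [l],
   and the clock gains [g] over each length [L]. *)
pose v := (1 + n * (b / 2)^-1)^-1.
have v0 : 0 < v.
  by rewrite invr_gt0; apply: ltr_pwDl => //; apply: mulr_ge0; rewrite ?invr_ge0; lra.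
have wv s u : almost_period h (b / 4) s -> `|u| < d -> v <= w (s + u).
  move=> hs /Hd hu; rewrite lef_pV2 ?posrE; last 2 first.
    by rewrite -invr_gt0.
    exact: lt_le_trans (S1 _).
  rewrite lerD2l /n -sum1_card natr_sum mulr_suml; apply: ler_sum => i _.
  rewrite mul1r lef_pV2 ?posrE//; last lra.
  have := hs (f i) u; have := hu (f i) 0; rewrite !add0r [u + s]addrC.
  by rewrite !ltr_norml => /andP[? _] /andP[? _]; have := wh i 0; rewrite -/b; lra.
pose L := l + d; pose g := v * (d / 2).
have g0 : 0 < g by apply: mulr_gt0 => //; lra.
have L0 : 0 < L by rewrite /L; lra.
have step x : g <= W (x + L) - W x.
  have [s hs sx] := Hl x.
  have G := @derive_ge_increment R W w s (s + d / 2) v _ (fun t _ => dW t).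
  have : v * (s + d / 2 - s) <= W (s + d / 2) - W s.
    apply: G => [|u su]; first lra.
    have -> : u = s + (u - s) by ring.
    by apply: wv => //; rewrite ger0_norm; lra.
  have -> : s + d / 2 - s = d / 2 by ring.
  rewrite -/g => ?.
  have : W x <= W s by apply: Wmono; lra.
  have : W (s + d / 2) <= W (x + L) by apply: Wmono; rewrite /L; lra.
  lra.
have steps k x : k%:R * g <= W (x + k%:R * L) - W x.
  elim: k => [|k IH]; first by rewrite !mul0r addr0 subrr.
  have := step (x + k%:R * L); rewrite -natr1 !mulrDl !mul1r !addrA; lra.
exists w, W, (g / L), g; split => //; split => //; first exact: divr_gt0.
move=> s t st.
have q0 : 0 <= (t - s) / L by apply: divr_ge0; lra.
have /andP[k1 k2] := truncn_itv q0.
have := steps (Num.truncn ((t - s) / L)) s.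
set k := (Num.truncn _)%:R in k1 k2 *.
have E : g / L * (t - s) = g * ((t - s) / L) by rewrite mulrAC mulrA.
have kk : (t - s) / L < k + 1 by rewrite /k natr1.
rewrite E => H.
have A1 : g * ((t - s) / L) <= g * (k + 1) by rewrite ler_pM2l// ltW.
have A2 : W (s + k * L) <= W t.
  by apply: Wmono; move: k1; rewrite ler_pdivlMr//; lra.
lra.
Qed.

(** The barrier is the solution [E] of [E' = - p * w * E + eta] with [p = th / 2], written by
    variation of constants. As [W] gains at most [r] over one delay, [E] was at most
    [exp (p * r) <= Q] times larger a delay earlier, which justifies the bound on the past offered
    to the contact hypothesis. The constants depend on the clock, [r] and [th] alone, not on [x] or
    [T]. *)
Lemma clock_decay (R : realType) (w W : R -> R) (c C r th Q : R) :
  clock w W c C -> 0 <= r -> 0 < th -> expR (th * r) <= Q ->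
  exists C1 C2 c', [/\ 0 < C1, 0 < C2, 0 < c' &
  forall (I : finType) (x dx : I -> R -> R) (T X0 eta : R),
  0 < X0 -> 0 <= eta ->
  (forall i t, T <= t -> is_derive t 1 (x i) (dx i t)) ->
  (forall i t, T <= t <= T + r -> x i t <= X0) ->
  (forall i t e, T + r <= t -> 0 < e -> x i t = e -> (forall j, x j t <= e) ->
    (forall j s, t - r <= s <= t -> x j s <= Q * e) ->
    dx i t <= - (th * w t * e) + eta) ->
  forall i t, T <= t -> x i t <= C1 * X0 * expR (- c' * (t - T)) + C2 * eta].
Proof.
move=> [c0 w01 dW growth] r0 th0 thQ.
pose p := th / 2; have p0 : 0 < p by exact: divr_gt0.
have cW : continuous (fun t => expR (p * W t)).
  move=> t; apply: continuous_comp; last exact: continuous_expR.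
  apply: continuousM; first exact: cst_continuous.
  exact: is_derive_continuous (dW t).
have [F [F0 dF]] := primitive_exists cW.
have W1 s t : s <= t -> W t - W s <= t - s.
  move=> st; have := @derive_le_increment R W w s t 1 st (fun t _ => dW t).
  by rewrite mul1r; apply => u _; case/andP: (w01 u).
have Fmono s t : s <= t -> F s <= F t.
  move=> st; have := @derive_ge_increment R F _ s t 0 st (fun t _ => dF t).
  by rewrite mul0r subr_ge0; apply => u _; exact: expR_ge0.
have Fbound s t : s <= t -> F t - F s <= expR (p * (W t + C)) / (p * c).
  move=> st.
  (* By the growth of the clock, [W u <= W t + C - c * (t - u)]; this exponential integrates
     explicitly. *)
  pose g u := expR (p * (W t + C - c * t)) / (p * c) * expR (p * c * u).
  have dg (u : R) : is_derive u 1 g (expR (p * (W t + C - c * t)) * expR (p * c * u)).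
    have D : is_derive u 1 (expR \o (p * c \*: id)) (expR (p * c * u) * (p * c *: 1)).
      by apply: is_derive1_comp.
    have -> : g = expR (p * (W t + C - c * t)) / (p * c) \*: (expR \o (p * c \*: id)).
      by apply/funext => v; rewrite /g !fctE.
    apply: is_derive_eq; rewrite /GRing.scale /= mulr1.
    by field; rewrite (gt_eqF c0) (gt_eqF p0).
  have := derive_increment_dominated st (fun u _ => dF u) (fun u _ => dg u).
  move=> H; apply: le_trans (H _) _ => [u /andP[su ut]|].
    rewrite -expRD ler_expR; have := growth u t ut.
    rewrite -mulrA -mulrDr ler_pM2l//; lra.
  have : g t = expR (p * (W t + C)) / (p * c).
    by rewrite /g mulrAC -expRD; congr (expR _ / _); ring.
  have : 0 <= g s.
    by rewrite /g !mulr_ge0 ?expR_ge0// invr_ge0 ltW// mulr_gt0.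
  lra.
pose C1 := 2 * expR (p * r) * expR (p * C).
pose C2 := expR (p * C) / (p * c).
exists C1, C2, (p * c); split.
- by rewrite /C1 !mulr_gt0 ?expR_gt0.
- by rewrite /C2 !divr_gt0 ?expR_gt0// mulr_gt0.
- exact: mulr_gt0.
move=> I x dx T X0 eta X00 eta0 dxP x0 contact.
(* The factor [expR (p * r)] keeps the barrier above [X0] during the whole initial window
   [[T, T + r]], and 2 makes this strict. *)
pose c1 := 2 * X0 * expR (p * r) * expR (p * W T).
have c10 : 0 < c1 by rewrite /c1 !mulr_gt0 ?expR_gt0.
pose G t := c1 + eta * (F t - F T).
have G0 t : T <= t -> 0 < G t.
  by move=> /Fmono ?; apply: ltr_pwDl => //; apply: mulr_ge0; rewrite ?subr_ge0.
have Gmono s t : s <= t -> G s <= G t.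
  by move=> /Fmono ?; rewrite lerD2l ler_wpM2l// lerB.
pose E t := expR (- p * W t) * G t.
pose dE t := - (p * w t * E t) + eta.
have dEP (t : R) : is_derive t 1 E (dE t).
  have D1 : is_derive t 1 (expR \o (- p \*: W)) (expR (- p * W t) * (- p *: w t)).
    by apply: is_derive1_comp; have := dW t => ?; exact: is_deriveZ.
  have D2 : is_derive t 1 (cst c1 + eta \*: (F - cst (F T))) (eta * expR (p * W t)).
    have := dF t => ?; apply: is_derive_eq.
    by rewrite /GRing.scale /= add0r subr0.
  have -> : E = (expR \o (- p \*: W)) * (cst c1 + eta \*: (F - cst (F T))).
    by apply/funext => v.
  apply: is_derive_eq; rewrite /dE /E /G !fctE /GRing.scale /=.
  have e1 : expR (- p * W t) * expR (p * W t) = 1.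
    by rewrite -expRD mulNr addNr expR0.
  transitivity (- (p * w t * (expR (- p * W t) * (c1 + eta * (F t - F T)))) +
     eta * (expR (- p * W t) * expR (p * W t))); last by rewrite e1 mulr1.
  have sE (a b : R) : a *: b = a * b by [].
  by rewrite !sE; ring.
have E0 t : T <= t -> 0 < E t by move=> Tt; rewrite mulr_gt0 ?expR_gt0 ?G0.
have Eback s t : T <= s -> t - r <= s <= t -> E s <= expR (p * r) * E t.
  move=> Ts /andP[ts st]; rewrite /E mulrA -expRD.
  apply: ler_pM; [exact: expR_ge0|exact/ltW/G0| |exact: Gmono].
  rewrite ler_expR; have := W1 s t st => Wst.
  have : p * (W t - W s) <= p * r by rewrite ler_pM2l//; lra.
  lra.
have Einit s : T <= s <= T + r -> X0 < E s.
  move=> /andP[Ts sr]; apply: (@lt_le_trans _ _ (expR (- p * W s) * c1)); last first.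
    rewrite ler_wpM2l ?expR_ge0// /G lerDl; apply: mulr_ge0 => //.
    by rewrite subr_ge0; exact: Fmono.
  have -> : expR (- p * W s) * c1 = 2 * X0 * expR (p * (r - (W s - W T))).
    have -> : p * (r - (W s - W T)) = - p * W s + p * r + p * W T by ring.
    by rewrite !expRD /c1; ring.
  have : 1 <= expR (p * (r - (W s - W T))).
    rewrite -expR0 ler_expR mulr_ge0//; first exact: ltW.
    by have := W1 T s Ts; lra.
  move=> e1; apply: (@lt_le_trans _ _ (2 * X0 * 1)); first lra.
  by rewrite ler_pM2l// mulr_gt0.
have Q1 : expR (p * r) <= Q.
  apply: le_trans thQ; rewrite ler_expR ler_wpM2r// /p; lra.
have main i t : T + r <= t -> x i t < E t.
  have Tr : T <= T + r by rewrite lerDl.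
  apply: (@first_contact R I x dx E dE (T + r)).
  - by move=> j s Ts; apply: dxP; exact: le_trans Ts.
  - by move=> j; apply: le_lt_trans (x0 j _ _) (Einit _ _); rewrite lexx andbT.
  move=> j s Trs below xE.
  have Ts : T <= s by apply: le_trans (ltW Trs).
  have Es := E0 s Ts.
  apply: le_lt_trans (contact j s (E s) (ltW Trs) Es xE _ _) _.
  - by move=> k; apply: below; rewrite lexx ltW.
  - move=> k u /andP[u1 u2]; have Tu : T <= u by lra.
    apply: (@le_trans _ _ (E u)).
      have [uT|Tru] := leP u (T + r); last by apply: below; rewrite u2 ltW.
      apply: le_trans (x0 k u _) (ltW (Einit u _)); by rewrite Tu uT.
    apply: le_trans (Eback u s Tu _) _; first by rewrite u1 u2.
    by rewrite ler_pM2r.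
  (* Halving [th] into [p] is what makes the contact inequality strict. *)
  - rewrite /dE ltrD2r ltrN2 -mulrA -mulrA ltr_pM2r; first by rewrite /p; lra.
    by apply: mulr_gt0 => //; case/andP: (w01 s).
move=> i t Tt.
apply: (@le_trans _ _ (E t)).
  have [tT|Trt] := leP t (T + r); last by apply: ltW; apply: main; exact: ltW.
  by apply: le_trans (x0 i t _) (ltW (Einit t _)); rewrite Tt tT.
rewrite /E /G mulrDr; apply: lerD.
  have -> : expR (- p * W t) * c1 = 2 * X0 * expR (p * r) * expR (- p * (W t - W T)).
    have -> : - p * (W t - W T) = - p * W t + p * W T by ring.
    by rewrite expRD /c1; ring.
  have -> : C1 * X0 * expR (- (p * c) * (t - T)) =
      2 * X0 * expR (p * r) * (expR (p * C) * expR (- (p * c) * (t - T))).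
    by rewrite /C1; ring.
  rewrite ler_pM2l; last by rewrite !mulr_gt0 ?expR_gt0.
  rewrite -expRD ler_expR.
  have : p * (c * (t - T) - C) <= p * (W t - W T) by rewrite ler_pM2l//; exact: growth.
  lra.
rewrite mulrCA mulrC ler_wpM2r//.
have -> : C2 = expR (- p * W t) * (expR (p * (W t + C)) / (p * c)).
  rewrite mulrA -expRD /C2; congr (expR _ / _); ring.
by rewrite ler_wpM2l ?expR_ge0// Fbound.
Qed.

(** * The Ricker nonlinearity *)

Section RickerEstimates.
Variable R : realType.
Implicit Types (a b c e g q u v k x : R).

Lemma expRN_ge1B x : 1 - x <= expR (- x).
Proof. exact: expR_ge1Dx. Qed.

Lemma expRN_le1 x : 0 <= x -> expR (- x) <= 1.
Proof. by move=> x0; rewrite expR_le1 oppr_le0. Qed.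

Lemma expRN_lipschitz u v : 0 <= u -> 0 <= v ->
  `|expR (- u) - expR (- v)| <= `|u - v|.
Proof.
wlog uv : u v / u <= v => [H u0 v0|u0 v0].
  have [uv|/ltW vu] := leP u v; first exact: H.
  by rewrite distrC [leRHS]distrC; exact: H.
rewrite ger0_norm; last by rewrite subr_ge0 ler_expR lerN2.
rewrite distrC ger0_norm ?subr_ge0//.
have -> : expR (- v) = expR (- u) * expR (- (v - u)).
  by rewrite -expRD; congr expR; ring.
have := expRN_ge1B (v - u); have := expRN_le1 u0; have := expR_ge0 (- u).
set E := expR (- u); set F := expR (- (v - u)) => E0 E1 F1.
have : E * (1 - F) <= 1 * (v - u).
  by apply: ler_pM => //; rewrite ?subr_ge0 ?expRN_le1 ?subr_ge0//; lra.
lra.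
Qed.

Lemma mulr_expRN_le1 x : x * expR (- x) <= 1.
Proof.
have : x <= expR x by have := expR_ge1Dx x; lra.
by rewrite expRN ler_pdivrMr ?expR_gt0// mul1r.
Qed.

(** The derivative [(1 - c * u) * exp (- c * u)] has modulus at most 1. The decrease is controlled
    by [x * exp (- x) <= 1], the increase by [exp (- c * u) <= 1]. *)
Lemma ricker_lipschitz c u v : 0 <= c -> 0 <= u -> 0 <= v ->
  `|u * expR (- c * u) - v * expR (- c * v)| <= `|u - v|.
Proof.
move=> c0; wlog vu : u v / v <= u => [H u0 v0|u0 v0].
  have [vu|/ltW uv] := leP v u; first exact: H.
  by rewrite distrC [leRHS]distrC; exact: H.
rewrite [leRHS]ger0_norm ?subr_ge0//.
have uvE : expR (- c * u) = expR (- c * v) * expR (- (c * (u - v))).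
  by rewrite -expRD; congr expR; ring.
have E1 : expR (- c * u) <= 1 by rewrite mulNr expRN_le1// mulr_ge0.
have le : expR (- c * u) <= expR (- c * v).
  by rewrite ler_expR !mulNr lerN2 ler_wpM2l.
rewrite ler_norml; apply/andP; split.
  have h1 : v * expR (- c * u) <= u * expR (- c * u).
    by rewrite ler_wpM2r ?expR_ge0.
  have : v * expR (- c * v) - v * expR (- c * u) <= u - v.
    rewrite uvE.
    have -> : v * expR (- c * v) - v * (expR (- c * v) * expR (- (c * (u - v)))) =
       v * expR (- c * v) * (1 - expR (- (c * (u - v)))) by ring.
    apply: (@le_trans _ _ (v * expR (- c * v) * (c * (u - v)))).
      rewrite ler_wpM2l ?mulr_ge0 ?expR_ge0//.
      by have := expRN_ge1B (c * (u - v)); lra.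
    have -> : v * expR (- c * v) * (c * (u - v)) = (c * v * expR (- (c * v))) * (u - v).
      by rewrite mulNr; ring.
    by rewrite -[leRHS]mul1r ler_wpM2r ?subr_ge0// mulr_expRN_le1.
  lra.
have h1 : v * expR (- c * u) <= v * expR (- c * v) by rewrite ler_wpM2l.
have : (u - v) * expR (- c * u) <= (u - v) * 1 by rewrite ler_wpM2l ?subr_ge0.
lra.
Qed.

Lemma ricker_le_max g0 g e u : 0 < g0 -> g0 <= g -> g <= 1 -> g <= e ->
  expR g * (u * expR (- e * u)) <= Num.max (3 / 2) (expR (- (g0 / 2)) * u).
Proof.
move=> g00 g0g g1 ge; have [u0|u0] := leP u 0.
  rewrite le_max; apply/orP; left; apply: (@le_trans _ _ 0); last lra.
  by rewrite pmulr_rle0 ?expR_gt0// pmulr_lle0 ?expR_gt0.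
have key : expR g * (u * expR (- e * u)) <= u * expR (g * (1 - u)).
  have -> : g * (1 - u) = g + - g * u by ring.
  rewrite expRD mulrCA ler_pM2l// ler_pM2l ?expR_gt0// ler_expR !mulNr lerN2.
  by rewrite ler_pM2r.
apply: le_trans key _; rewrite le_max.
have [u32|u32] := leP u (3 / 2); last first.
  apply/orP; right; rewrite mulrC ler_pM2r// ler_expR.
  have : g * (u - 1) >= g0 * (1 / 2) by apply: ler_pM; lra.
  lra.
apply/orP; left; have [u1|u1] := leP u 1; last first.
  apply: (@le_trans _ _ (u * 1)); last lra.
  by rewrite ler_pM2l// expR_le1; rewrite pmulr_rle0; lra.
apply: (@le_trans _ _ (u * expR (1 - u))).
  by rewrite ler_pM2l// ler_expR -[leRHS]mul1r ler_wpM2r//; lra.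
have : u <= expR (- (1 - u)) by have := expR_ge1Dx (- (1 - u)); lra.
rewrite expRN => ule.
have : u * expR (1 - u) <= (expR (1 - u))^-1 * expR (1 - u).
  by rewrite ler_pM2r ?expR_gt0.
by rewrite mulVf ?gt_eqF ?expR_gt0//; lra.
Qed.

(** The logarithmic mean of [a] and [b] lies between them; written without division, this holds
    whatever their order. Both halves are [ln x <= x - 1]. *)
Lemma lnB_bounds a b : 0 < a -> 0 < b ->
  b * (ln a - ln b) <= a - b <= a * (ln a - ln b).
Proof.
have le u v : 0 < u -> 0 < v -> v * (ln u - ln v) <= u - v.
  move=> u0 v0; rewrite -ln_div ?posrE// mulrC -ler_pdivlMr// mulrDl mulNr divff ?gt_eqF//.
  have uv0 : 0 < u / v by exact: divr_gt0.
  have -> : u / v = 1 + (u / v - 1) by ring.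
  have := @le_ln1Dx R (u / v - 1); have -> : 1 + (u / v - 1) = u / v by ring.
  by move=> H; apply: le_trans (H _) _; lra.
move=> a0 b0; apply/andP; split; first exact: le.
have := le b a b0 a0.
lra.
Qed.

(* The logarithmic derivative of [u * exp (- c * u)] in [ln u] is [1 - c * u],
   of modulus less than 1 as long as [c * u < 2]. *)
Lemma ln_ricker_contraction c nu a b k e :
  0 < a -> 0 < b -> 0 <= c -> nu <= c * a -> nu <= c * b ->
  c * a <= 7 / 4 -> c * b <= 7 / 4 ->
  3 / 4 <= k -> 1 - nu <= k -> `|ln a - ln b| <= e ->
  (ln a - c * a) - (ln b - c * b) <= k * e.
Proof.
move=> a0 b0 c0 na nb a7 b7 k34 kn.
have /andP[l1 l2] := lnB_bounds a0 b0.
set X := ln a - ln b in l1 l2 * => Xe.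
have -> : ln a - c * a - (ln b - c * b) = X - c * (a - b) by rewrite /X; ring.
have k0 : 0 <= k by lra.
(* Both signs use [c * (a - b) >= c * b * X], which leaves [(1 - c * b) * X]. The factor is at most
   [1 - nu] if [X >= 0]; otherwise [c * b - 1] is at most [7 / 4 - 1 = 3 / 4]. *)
have [X0|/ltW X0] := leP 0 X.
  apply: (@le_trans _ _ ((1 - c * b) * X)).
    have : c * (b * X) <= c * (a - b) by rewrite ler_wpM2l.
    lra.
  apply: (@le_trans _ _ (k * X)); first by rewrite ler_wpM2r//; lra.
  by rewrite ler_wpM2l// (le_trans _ Xe)// ler_norm.
apply: (@le_trans _ _ ((c * b - 1) * - X)).
  have : c * (b * X) <= c * (a - b) by rewrite ler_wpM2l.
  lra.
apply: (@le_trans _ _ (k * - X)); first by rewrite ler_wpM2r//; lra.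
by rewrite ler_wpM2l// (le_trans _ Xe)// -normrN ler_norm.
Qed.

Lemma small_rate r a b : 0 <= r -> 0 < a -> 0 < b ->
  exists th, [/\ 0 < th, th * r <= a & th <= b].
Proof.
move=> r0 a0 b0; exists (Num.min b (a / (r + 1))).
have r1 : 0 < r + 1 by lra.
split; last by rewrite ge_min lexx.
  by rewrite lt_min b0 divr_gt0.
apply: (@le_trans _ _ (a / (r + 1) * r)); first by rewrite ler_wpM2r// ge_min lexx orbT.
by rewrite mulrAC ler_pdivrMr// ler_pM2l//; lra.
Qed.

Lemma exp_decay_eventually_le a c e : 0 <= a -> 0 < c -> 0 < e ->
  exists2 s, 0 <= s & forall t, s <= t -> a * expR (- c * t) <= e.
Proof.
move=> a0 c0 e0; exists (a / (c * e)) => [|t st].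
  by rewrite divr_ge0// mulr_ge0// ltW.
have ct : a / e <= c * t.
  have : c * (a / (c * e)) <= c * t by rewrite ler_pM2l.
  by have -> : c * (a / (c * e)) = a / e by field; rewrite !gt_eqF.
have : a / e <= expR (c * t) by have := expR_ge1Dx (c * t); lra.
by rewrite mulNr expRN !ler_pdivrMr ?expR_gt0// mulrC.
Qed.

Lemma one_sub_expRN_ge x X : 0 <= x <= X -> x / (1 + X) <= 1 - expR (- x).
Proof.
move=> /andP[x0 xX].
have x1 : 0 < 1 + x by lra.
have : expR (- x) <= (1 + x)^-1.
  by rewrite expRN lef_pV2 ?posrE ?expR_gt0//; exact: expR_ge1Dx.
have : x / (1 + X) <= x / (1 + x).
  by rewrite ler_wpM2l// lef_pV2 ?posrE//; lra.
have -> : x / (1 + x) = 1 - (1 + x)^-1 by field; rewrite gt_eqF.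
lra.
Qed.

End RickerEstimates.

(** * Nicholson systems *)

(** All coefficients form one family over a finite type, so that a single almost period serves them
    all. *)
Definition coef (R : realType) (m : nat) (N : nicholson R m)
    (k : 'I_m * 'I_m + ('I_m + ('I_m + 'I_m))) : R -> R :=
  match k with
  | inl (i, j) => acoef N i j
  | inr (inl i) => dcoef N i
  | inr (inr (inl i)) => ccoef N i
  | inr (inr (inr i)) => bcoef N i
  end.

Section NicholsonDefinitions.
Variables (R : realType) (m : nat) (N : nicholson R m).
Implicit Types (y dy : 'I_m -> R -> R) (T t : R).

(** A common bound for the delays, meaningful also for [m = 0]. *)
Definition total_delay : R := \sum_i delay N i.

(** The net damping of [csup N i * y i] when all the scaled components are equal. It is the
    denominator of the theorem's hypothesis, once the vanishing diagonal term is added. *)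
Definition dominance t i : R :=
  dcoef N i t - \sum_(j < m) acoef N i j t * (csup N i / csup N j).

Definition in_region (M : R) y T : Prop :=
  forall i t, T <= t -> M <= y i t /\ csup N i * y i t <= 7 / 4.

(** The defect is bounded only from [T + total_delay] on, where all delayed arguments are at least
    [T]. *)
Definition approximate_solution (e : R) y dy T : Prop :=
  forall i t, T <= t -> is_derive t 1 (y i) (dy i t) /\
    (T + total_delay <= t -> `|dy i t - nicholson_rhs N y i t| <= e).

End NicholsonDefinitions.

Section NicholsonDynamics.
Variables (R : realType) (m : nat) (N : nicholson R m) (B c0 : R).
Hypothesis delay_gt0 : forall i, 0 < delay N i.
Hypothesis apN : forall k, almost_periodic (coef N k).
Hypothesis B_gt0 : 0 < B.
Hypothesis coef_le : forall k t, `|coef N k t| <= B.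
Hypothesis acoef_ge0 : forall i j t, 0 <= acoef N i j t.
Hypothesis bcoef_gt0 : forall t i, 0 < bcoef N i t.
Hypothesis c0_gt0 : 0 < c0.
Hypothesis ccoef_ge : forall t i, c0 <= ccoef N i t.
Hypothesis bcoef_le : forall t i, bcoef N i t <= expR (cinf N i / csup N i) * dominance N t i.

Implicit Types (y w p z dz : 'I_m -> R -> R) (i j : 'I_m) (s t T : R).

Local Notation r := (total_delay N).

Local Notation dom := (dominance N).
Local Notation region := (in_region N).
Local Notation approx_solution := (approximate_solution N).

(** * Bounds on the coefficients and the eventual upper bound of solutions *)

Lemma delay_le i : delay N i <= r.
Proof.
rewrite /total_delay (bigD1 i)//= lerDl; apply: sumr_ge0 => j _; exact: ltW.
Qed.

Lemma total_delay_ge0 : 0 <= r.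
Proof. by apply: sumr_ge0 => j _; exact: ltW. Qed.

Lemma dcoef_le i t : `|dcoef N i t| <= B.
Proof. exact: (coef_le (inr (inl i))). Qed.
Lemma acoef_le i j t : `|acoef N i j t| <= B.
Proof. exact: (coef_le (inl (i, j))). Qed.
Lemma ccoef_le i t : `|ccoef N i t| <= B.
Proof. exact: (coef_le (inr (inr (inl i)))). Qed.
Lemma bcoef_le_bound i t : `|bcoef N i t| <= B.
Proof. exact: (coef_le (inr (inr (inr i)))). Qed.

Lemma ccoef_gt0 i t : 0 < ccoef N i t.
Proof. exact: lt_le_trans (ccoef_ge t i). Qed.

Lemma ccoef_le_csup i t : ccoef N i t <= csup N i.
Proof.
apply: ub_le_sup; last by exists t.
by exists B => _ [s _ <-]; exact: le_trans (ler_norm _) (ccoef_le i s).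
Qed.

Lemma csup_le i : csup N i <= B.
Proof.
apply: ge_sup; first by exists (ccoef N i 0), 0.
by move=> _ [s _ <-]; exact: le_trans (ler_norm _) (ccoef_le i s).
Qed.

Lemma csup_ge i : c0 <= csup N i.
Proof. exact: le_trans (ccoef_ge 0 i) (ccoef_le_csup i 0). Qed.

Lemma csup_gt0 i : 0 < csup N i.
Proof. exact: lt_le_trans (csup_ge i). Qed.

Lemma cinf_le_ccoef i t : cinf N i <= ccoef N i t.
Proof.
apply: ge_inf; last by exists t.
by exists c0 => _ [s _ <-]; exact: ccoef_ge.
Qed.

Lemma cinf_ge i : c0 <= cinf N i.
Proof.
apply: lb_le_inf; first by exists (ccoef N i 0), 0.
by move=> _ [s _ <-]; exact: ccoef_ge.
Qed.

Lemma gamma_ge i : c0 / B <= cinf N i / csup N i.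
Proof.
apply: ler_pM; rewrite ?invr_ge0 ?(ltW B_gt0) ?(ltW c0_gt0)//; first exact: cinf_ge.
by rewrite lef_pV2 ?posrE ?csup_gt0// csup_le.
Qed.

Lemma gamma_le1 i : cinf N i / csup N i <= 1.
Proof.
rewrite ler_pdivrMr ?csup_gt0// mul1r.
exact: le_trans (cinf_le_ccoef i 0) (ccoef_le_csup i 0).
Qed.

Lemma bcoef_le_dom i t : bcoef N i t <= expR 1 * dom t i.
Proof.
have H := bcoef_le t i.
have dom0 : 0 < dom t i.
  by have := lt_le_trans (bcoef_gt0 t i) H; rewrite pmulr_rgt0 ?expR_gt0.
apply: le_trans H _; rewrite ler_pM2r// ler_expR; exact: gamma_le1.
Qed.

Lemma dom_gt0 i t : 0 < dom t i.
Proof.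
by have := lt_le_trans (bcoef_gt0 t i) (bcoef_le_dom i t); rewrite pmulr_rgt0 ?expR_gt0.
Qed.

(** In the variable [u = csup N i * v] the exponent is [ccoef N i t / csup N i], at least
    [cinf N i / csup N i]; the assumed bound on [bcoef] supplies exactly the matching factor of
    [ricker_le_max]. *)
Lemma feedback_le i t v :
  csup N i * (bcoef N i t * v * expR (- ccoef N i t * v)) <=
  dom t i * Num.max (3 / 2) (expR (- (c0 / B / 2)) * (csup N i * v)).
Proof.
have k0 := csup_gt0 i.
have [v0|v0] := leP v 0.
  apply: (@le_trans _ _ 0).
    rewrite pmulr_rle0// pmulr_lle0 ?expR_gt0// pmulr_rle0//.
  by rewrite mulr_ge0 ?(ltW (dom_gt0 _ _))// le_max; apply/orP; left; lra.
set g := cinf N i / csup N i.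
have g00 : 0 < c0 / B by exact: divr_gt0.
have gcc : g <= ccoef N i t / csup N i.
  by rewrite ler_pM2r ?invr_gt0// cinf_le_ccoef.
have := ricker_le_max (csup N i * v) g00 (gamma_ge i) (gamma_le1 i) gcc.
have -> : - (ccoef N i t / csup N i) * (csup N i * v) = - ccoef N i t * v.
  by field; rewrite gt_eqF.
rewrite -/g => H.
apply: (@le_trans _ _ (dom t i * (expR g * (csup N i * v * expR (- ccoef N i t * v))))).
  have -> : csup N i * (bcoef N i t * v * expR (- ccoef N i t * v)) =
    bcoef N i t * (csup N i * v * expR (- ccoef N i t * v)) by ring.
  have -> : dom t i * (expR g * (csup N i * v * expR (- ccoef N i t * v))) =
    expR g * dom t i * (csup N i * v * expR (- ccoef N i t * v)) by ring.
  by rewrite ler_wpM2r ?bcoef_le// mulr_ge0 ?expR_ge0// mulr_ge0// ltW.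
by rewrite ler_pM2l ?dom_gt0.
Qed.

Let coef_clock : exists (w : R -> R) W c C, @clock R w W c C /\ forall i t, w t <= bcoef N i t.
Proof.
have [w [W [c [C [ck wb]]]]] :=
  clock_exists (f := fun i => inr (inr (inr i))) apN (fun i t => bcoef_gt0 t i).
by exists w, W, c, C.
Qed.

(** When the largest excess of [csup N i * y i] over 3 / 2 equals [e], damping and coupling
    contribute at most [- dom * (3 / 2 + e)] and the feedback at most [dom * (3 / 2 + k * e)] with
    [k < 1]. The excess thus decays by the clock lemma with [eta = 0]. *)
Lemma eventually_le_upper_bound y T :
  (forall i t, T <= t -> is_derive t 1 (y i) (nicholson_rhs N y i t)) ->
  exists2 T', T <= T' & forall i t, T' <= t -> csup N i * y i t <= 7 / 4.
Proof.
move=> dy.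
have [w [W [c [C [ck wb]]]]] := coef_clock.
have g00 : 0 < c0 / B by exact: divr_gt0.
set q := expR (- (c0 / B / 2)).
pose Q := expR (c0 / B / 4); pose k := expR (- (c0 / B / 4)).
have qQ : q * Q = k by rewrite /q /Q -expRD; congr expR; field; rewrite gt_eqF.
have k1 : 0 < 1 - k by rewrite subr_gt0 expR_lt1 oppr_lt0; lra.
have q0 : 0 <= q by exact: expR_ge0.
(* The factor [expR (- 1)] is there because the clock is slower than [bcoef], which is at most
   [expR 1 * dom]. *)
have [th [th0 thr thk]] := @small_rate R r (c0 / B / 4) (expR (- 1) * (1 - k))
  total_delay_ge0 (divr_gt0 g00 (ltr0Sn _ 3)) (mulr_gt0 (expR_gt0 _) k1).
have thQ : expR (th * r) <= Q by rewrite ler_expR.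
have [C1 [C2 [c' [C10 C20 c'0 decay]]]] := clock_decay ck total_delay_ge0 th0 thQ.
pose x i t := csup N i * y i t - 3 / 2.
pose dx i t := csup N i * nicholson_rhs N y i t.
have dxP i (t : R) : T <= t -> is_derive t 1 (x i) (dx i t).
  move=> /(dy i) ?; have D : is_derive t 1 (csup N i \*: y i - cst (3 / 2))
    (csup N i *: nicholson_rhs N y i t - 0) by apply: is_deriveB.
  by rewrite /dx -[X in is_derive _ _ _ X]subr0.
have [X0 X00 xX0] : exists2 X0, 0 < X0 & forall i t, T <= t <= T + r -> x i t <= X0.
  have /choice [b bP] i : exists b, 0 < b /\ forall t, T <= t <= T + r -> `|x i t| <= b.
    have [|b b0 Hb] := @within_continuous_bounded R (x i) T (T + r); last by exists b.
    apply: derivable_within_continuous => t; rewrite in_itv/= => /andP[Tt _].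
    by have := dxP i t Tt => ?; exact: ex_derive.
  have b0 i : 0 <= b i by case: (bP i) => /ltW.
  exists (1 + \sum_i b i) => [|i t tT].
    by have : 0 <= \sum_i b i; [apply: sumr_ge0|lra].
  have [_ /(_ t tT) Hb] := bP i; apply: le_trans (ler_norm _) _; apply: le_trans Hb _.
  rewrite (bigD1 i)//=; have : 0 <= \sum_(j | j != i) b j by apply: sumr_ge0.
  lra.
have bound := decay 'I_m x dx T X0 0 X00 (lexx 0) dxP xX0.
have CX0 : 0 <= C1 * X0 by rewrite mulr_ge0 ?ltW.
(* The room between the two levels: [7 / 4 - 3 / 2 = 1 / 4]. *)
have [s s0 Hs] := exp_decay_eventually_le CX0 c'0 (ltac:(lra) : 0 < 1 / 4 :> R).
exists (T + s) => [|i t st]; first by rewrite lerDl.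
have : x i t <= C1 * X0 * expR (- c' * (t - T)) + C2 * 0.
  apply: bound; last lra.
  move=> {st}{}i {}t e Tt e0 xe xle xback; rewrite addr0.
  have yE j : csup N j * y j t = 3 / 2 + x j t by rewrite /x; ring.
  have yd : csup N i * y i (t - delay N i) <= 3 / 2 + Q * e.
    have := xback i (t - delay N i); rewrite /x.
    have := delay_le i; have := delay_gt0 i => d1 d2 H.
    suff : csup N i * y i (t - delay N i) - 3 / 2 <= Q * e by lra.
    by apply: H; apply/andP; split; lra.
  have coupling : csup N i * (\sum_(j < m) acoef N i j t * y j t) <=
      (3 / 2 + e) * \sum_(j < m) acoef N i j t * (csup N i / csup N j).
    rewrite !mulr_sumr; apply: ler_sum => j _.
    have kj := csup_gt0 j; have ki := csup_gt0 i.
    have -> : csup N i * (acoef N i j t * y j t) =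
      (csup N j * y j t) * (acoef N i j t * (csup N i / csup N j)).
      by field; rewrite gt_eqF.
    rewrite ler_wpM2r//; last by rewrite yE lerD2l xle.
    by rewrite mulr_ge0// divr_ge0 ?ltW.
  have feed := feedback_le i t (y i (t - delay N i)).
  have mx : Num.max (3 / 2) (q * (csup N i * y i (t - delay N i))) <= 3 / 2 + k * e.
    have k00 : 0 <= k * e by rewrite mulr_ge0 ?expR_ge0// ltW.
    rewrite ge_max; apply/andP; split; first lra.
    apply: (@le_trans _ _ (q * (3 / 2 + Q * e))); first by rewrite ler_wpM2l.
    rewrite mulrDr mulrA qQ.
    have : q <= 1 by rewrite /q expR_le1; lra.
    lra.
  have feed' : csup N i * (bcoef N i t * y i (t - delay N i) *
      expR (- ccoef N i t * y i (t - delay N i))) <= dom t i * (3 / 2 + k * e).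
    by apply: le_trans feed _; rewrite ler_pM2l ?dom_gt0.
  have damp : th * w t * e <= dom t i * (1 - k) * e.
    rewrite ler_pM2r//.
    have h1 : w t <= expR 1 * dom t i by exact: le_trans (wb i t) (bcoef_le_dom i t).
    have w0 : 0 <= w t by case: ck => _ /(_ t) /andP[/ltW].
    apply: (@le_trans _ _ (expR (- 1) * (1 - k) * (expR 1 * dom t i))).
      by apply: ler_pM => //; exact: ltW.
    have -> : expR (- 1) * (1 - k) * (expR 1 * dom t i) =
       (expR (- 1) * expR 1) * (dom t i * (1 - k)) by ring.
    by rewrite -expRD addNr expR0 mul1r.
  have -> : dx i t = - dcoef N i t * (csup N i * y i t) +
     csup N i * (\sum_(j < m) acoef N i j t * y j t) +
     csup N i * (bcoef N i t * y i (t - delay N i) *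
      expR (- ccoef N i t * y i (t - delay N i))).
    by rewrite /dx /nicholson_rhs; ring.
  rewrite yE xe; move: coupling feed' damp; rewrite /dominance.
  set S1 := csup N i * _; set S2 := csup N i * _; set S := \sum_(j < m) _.
  lra.
rewrite mulr0 addr0 => H; have := Hs (t - T) _ => /(_ _)/wrap[|]; first lra.
by move: H; rewrite /x; lra.
Qed.


(** * Exponential merging of approximate solutions *)

Let ub : R := 7 / (4 * c0).

Lemma region_le_ub y i t : 0 < y i t -> csup N i * y i t <= 7 / 4 -> y i t <= ub.
Proof.
move=> y0 y7; have k0 := csup_gt0 i.
have : c0 * y i t <= 7 / 4.
  by apply: le_trans y7; rewrite ler_pM2r// csup_ge.
have -> : ub = (7 / 4) / c0 by rewrite /ub; field; rewrite gt_eqF.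
by move=> H; rewrite ler_pdivlMr// mulrC.
Qed.

Lemma region_ccoef_le y i s t : 0 < y i s -> csup N i * y i s <= 7 / 4 ->
  ccoef N i t * y i s <= 7 / 4.
Proof.
by move=> y0 y7; apply: le_trans y7; rewrite ler_pM2r// ccoef_le_csup.
Qed.

(* At a time where the largest log-ratio is attained by component [i], the
   coupling terms do not increase it and the delayed term strictly decreases it. *)
Lemma log_ratio_contact M k Q y w i t e :
  0 < M -> 3 / 4 <= k -> 1 - c0 * M <= k -> k < 1 -> 0 < Q -> k * Q < 1 -> 0 < e ->
  e <= ub / M ->
  (forall j, M <= y j t /\ csup N j * y j t <= 7 / 4) ->
  (forall j, M <= w j t /\ csup N j * w j t <= 7 / 4) ->
  M <= y i (t - delay N i) /\ csup N i * y i (t - delay N i) <= 7 / 4 ->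
  M <= w i (t - delay N i) /\ csup N i * w i (t - delay N i) <= 7 / 4 ->
  ln (y i t) - ln (w i t) = e ->
  (forall j, ln (y j t) - ln (w j t) <= e) ->
  `|ln (y i (t - delay N i)) - ln (w i (t - delay N i))| <= Q * e ->
  nicholson_rhs N y i t / y i t - nicholson_rhs N w i t / w i t <=
  - (bcoef N i t * (M * expR (- (7 / 4)) / ub * ((1 - k * Q) / (1 + ub / M))) * e).
Proof.
move=> M0 k34 kM k1 Q0 kQ e0 eub ry rw [ydM yd7] [wdM wd7] xe xle xd.
have y0 j : 0 < y j t by case: (ry j) => /(lt_le_trans M0).
have w0 j : 0 < w j t by case: (rw j) => /(lt_le_trans M0).
have yd0 : 0 < y i (t - delay N i) by exact: lt_le_trans M0 ydM.
have wd0 : 0 < w i (t - delay N i) by exact: lt_le_trans M0 wdM.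
have ub0 : 0 < ub by rewrite /ub divr_gt0// mulr_gt0.
have cc : 0 <= ccoef N i t by exact/ltW/ccoef_gt0.
have c0M u : M <= u -> c0 * M <= ccoef N i t * u.
  by move=> Mu; apply: ler_pM => //; exact: ltW.
have ratio j : y j t / y i t <= w j t / w i t.
  rewrite -ler_ln ?posrE ?divr_gt0// !ln_div ?posrE//.
  by have := xle j; lra.
have yw : y i t = w i t * expR e.
  apply: ln_inj; rewrite ?posrE ?mulr_gt0 ?expR_gt0//.
  by rewrite lnM ?posrE ?expR_gt0// expRK; lra.
have := @ln_ricker_contraction R (ccoef N i t) (c0 * M) _ _ k (Q * e) yd0 wd0 cc
  (c0M _ ydM) (c0M _ wdM) (region_ccoef_le t yd0 yd7) (region_ccoef_le t wd0 wd7) k34 kM xd.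
set a := y i (t - delay N i) in yd0 *; set b := w i (t - delay N i) in wd0 wdM wd7 *.
set c := ccoef N i t => lnle.
(* The delayed log-ratio is at most [Q * e], and the contraction turns it into [k * Q * e]. Division
   by [y i t = w i t * expR e] then leaves a factor below 1. *)
have rick : a * expR (- c * a) <= b * expR (- c * b) * expR (k * Q * e).
  rewrite -ler_ln ?posrE ?mulr_gt0 ?expR_gt0// !lnM ?posrE ?mulr_gt0 ?expR_gt0//.
  by rewrite !expRK; lra.
have fall : a * expR (- c * a) / y i t <=
    b * expR (- c * b) / w i t * expR (- ((1 - k * Q) * e)).
  rewrite yw invfM mulrA.
  have -> : expR (- ((1 - k * Q) * e)) = expR (k * Q * e) * (expR e)^-1.
    by rewrite -expRN -expRD; congr expR; ring.
  rewrite [leRHS]mulrA ler_pM2r ?invr_gt0 ?expR_gt0//.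
  by rewrite [leRHS]mulrAC ler_pM2r ?invr_gt0.
(* As [e] ranges over a bounded interval, the exponential gain is bounded below by a linear one. *)
have frac : (1 - k * Q) * e / (1 + ub / M) <= 1 - expR (- ((1 - k * Q) * e)).
  apply: one_sub_expRN_ge; apply/andP; split.
    by rewrite mulr_ge0 ?subr_ge0 ?ltW.
  apply: le_trans eub; rewrite -[leRHS]mul1r ler_pM2r//.
  have : 0 <= k * Q by rewrite mulr_ge0 ?(ltW Q0)//; lra.
  lra.
have lower : M * expR (- (7 / 4)) / ub <= b * expR (- c * b) / w i t.
  apply: ler_pM.
  - by rewrite mulr_ge0 ?expR_ge0// ltW.
  - by rewrite invr_ge0 ltW.
  - apply: ler_pM; rewrite ?expR_ge0 ?(ltW M0)//.
    by rewrite ler_expR mulNr lerN2 region_ccoef_le.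
  - rewrite lef_pV2 ?posrE//; case: (rw i) => _; exact: region_le_ub.
set Lam := M * expR (- (7 / 4)) / ub in lower *.
set G := b * expR (- c * b) / w i t in fall lower *.
have Lam0 : 0 < Lam by rewrite /Lam divr_gt0// mulr_gt0// expR_gt0.
have nonlin : a * expR (- c * a) / y i t - G <= - (Lam * ((1 - k * Q) / (1 + ub / M)) * e).
  have : Lam * ((1 - k * Q) * e / (1 + ub / M)) <= G * (1 - expR (- ((1 - k * Q) * e))).
    apply: ler_pM => //; first exact: ltW.
    rewrite divr_ge0 ?mulr_ge0 ?subr_ge0 ?(ltW e0) ?(ltW kQ)//.
    by rewrite addr_ge0// divr_ge0// ltW.
  have -> : Lam * ((1 - k * Q) / (1 + ub / M)) * e = Lam * ((1 - k * Q) * e / (1 + ub / M)).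
    by ring.
  lra.
(* The damping rate [dcoef] cancels, and the coupling sums compare term by term by [ratio]. *)
have -> : nicholson_rhs N y i t / y i t - nicholson_rhs N w i t / w i t =
  (\sum_(j < m) acoef N i j t * (y j t / y i t) -
   \sum_(j < m) acoef N i j t * (w j t / w i t)) +
  bcoef N i t * (a * expR (- c * a) / y i t - G).
  rewrite /nicholson_rhs -/a -/b -/c /G.
  have sE z : \sum_(j < m) acoef N i j t * (z j t / z i t) =
     (\sum_(j < m) acoef N i j t * z j t) / z i t.
    by rewrite mulr_suml; apply: eq_bigr => j _; rewrite mulrA.
  rewrite !sE; field; rewrite !gt_eqF//.
have sum_le : \sum_(j < m) acoef N i j t * (y j t / y i t) <=
   \sum_(j < m) acoef N i j t * (w j t / w i t).
  by apply: ler_sum => j _; rewrite ler_wpM2l.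
have : bcoef N i t * (a * expR (- c * a) / y i t - G) <=
  bcoef N i t * (- (Lam * ((1 - k * Q) / (1 + ub / M)) * e)).
  by rewrite ler_pM2l.
lra.
Qed.

(** The clock lemma is applied to the log-ratios; a defect [e] becomes at most [e / M] after
    division by a component, hence [2 * (e / M)] for two approximate solutions. The mean value bound
    for [ln] then returns to differences. *)
Lemma approx_solutions_merge M : 0 < M ->
  exists C1 C2 c', [/\ 0 < C1, 0 < C2, 0 < c' &
  forall y w dy dw T e, 0 <= e -> region M y T -> region M w T ->
  approx_solution e y dy T -> approx_solution e w dw T ->
  forall i t, T <= t -> `|y i t - w i t| <= C1 * expR (- c' * (t - T)) + C2 * e].
Proof.
move=> M0.
have [om [W [c [C [ck wb]]]]] := coef_clock.
have ub0 : 0 < ub by rewrite /ub divr_gt0// mulr_gt0.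
pose k := Num.max (3 / 4) (1 - c0 * M).
have cM : 0 < c0 * M by exact: mulr_gt0.
have k34 : 3 / 4 <= k by rewrite /k le_max lexx.
have kM : 1 - c0 * M <= k by rewrite /k le_max lexx orbT.
have k1 : k < 1 by rewrite /k gt_max; apply/andP; split; lra.
(* This lies strictly between 1 and [1 / k]. *)
pose Q := 2 / (1 + k).
have Q1 : 1 < Q by rewrite /Q ltr_pdivlMr; lra.
have kQ : k * Q < 1 by rewrite /Q mulrA ltr_pdivrMr; lra.
have Q0 : 0 < Q by lra.
have lnQ0 : 0 < ln Q by exact: ln_gt0.
set Lam := M * expR (- (7 / 4)) / ub * ((1 - k * Q) / (1 + ub / M)).
have ubM : 0 < ub / M by exact: divr_gt0.
have Lam0 : 0 < Lam.
  by rewrite /Lam !mulr_gt0 ?expR_gt0 ?invr_gt0 ?subr_gt0//; lra.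
have [th [th0 thr thL]] := small_rate total_delay_ge0 lnQ0 Lam0.
have thQ : expR (th * r) <= Q by rewrite -[leRHS]lnK ?posrE// ler_expR.
have [C1 [C2 [c' [C10 C20 c'0 decay]]]] := clock_decay ck total_delay_ge0 th0 thQ.
exists (ub * (C1 * (ub / M))), (ub * (C2 * (2 / M))), c'.
split => //.
- by do 2 apply: mulr_gt0 => //.
- by do 2 apply: mulr_gt0 => //; apply: divr_gt0.
move=> y w dy dw T e e0 ry rw ay aw.
(* The boolean selects the sign of the log-ratio, so that one-sided barriers bound its modulus, at
   present and at delayed times. *)
pose x (b : 'I_m * bool) t : R :=
  if b.2 then ln (y b.1 t) - ln (w b.1 t) else ln (w b.1 t) - ln (y b.1 t).
pose dx (b : 'I_m * bool) t : R :=
  if b.2 then dy b.1 t / y b.1 t - dw b.1 t / w b.1 t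
  else dw b.1 t / w b.1 t - dy b.1 t / y b.1 t.
have pos z : region M z T -> forall i t, T <= t -> 0 < z i t.
  by move=> rz i t /(rz i) [/(lt_le_trans M0)].
have y0 := pos _ ry; have w0 := pos _ rw.
have dln z dz i (t : R) : 0 < z i t -> is_derive t 1 (z i) (dz i t) ->
    is_derive t 1 (fun u => ln (z i u)) (dz i t / z i t).
  move=> z0 D; rewrite mulrC.
  by have := is_derive1_ln z0 => D'; exact: is_derive1_comp.
have lnub (z : 'I_m -> R -> R) i t : region M z T -> T <= t -> ln M <= ln (z i t) <= ln ub.
  move=> rz Tt; have [zM z7] := rz i t Tt.
  by rewrite !ler_ln ?posrE ?zM ?(pos _ rz)// region_le_ub ?(pos _ rz).
have lnubM : ln ub - ln M <= ub / M.
  by rewrite -ln_div ?posrE//; exact/ltW/ln_sublinear.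
have xub b t : T <= t -> x b t <= ub / M.
  move=> Tt; rewrite /x; have := lnub y b.1 t ry Tt; have := lnub w b.1 t rw Tt.
  by move=> /andP[? ?] /andP[? ?]; case: ifP => _; lra.
have slope z dz i t : region M z T -> approx_solution e z dz T -> T + r <= t ->
    `|dz i t / z i t - nicholson_rhs N z i t / z i t| <= e / M.
  move=> rz az Tt.
  have Tt' : T <= t by have := total_delay_ge0; lra.
  have [_ /(_ Tt) H] := az i t Tt'; have [zM _] := rz i t Tt'.
  have z0 := pos _ rz i t Tt'.
  rewrite -mulrBl normrM normfV; apply: ler_pM => //.
  by rewrite lef_pV2 ?posrE ?normr_gt0 ?gt_eqF// gtr0_norm.
have main b t : T <= t -> x b t <= C1 * (ub / M) * expR (- c' * (t - T)) + C2 * (2 * (e / M)).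
  apply: (decay _ x dx) => //.
  - by rewrite mulr_ge0// divr_ge0// ltW.
  - move=> {}b {}t Tt; rewrite /x /dx.
    have [Dy _] := ay b.1 t Tt; have [Dw _] := aw b.1 t Tt.
    have Ly := dln _ _ _ _ (y0 b.1 t Tt) Dy; have Lw := dln _ _ _ _ (w0 b.1 t Tt) Dw.
    by case: b.2; exact: is_deriveB.
  - by move=> {}b {}t /andP[Tt _]; exact: xub.
  move=> {b} [i b] {}t f Tt f0 xf xle xback.
  have rd := delay_le i; have d0 := delay_gt0 i; have r0 := total_delay_ge0.
  have Tt' : T <= t by lra.
  have Td : T <= t - delay N i by lra.
  have fub : f <= ub / M by rewrite -xf; exact: xub.
  have xd1 := xback (i, true) (t - delay N i); have xd2 := xback (i, false) (t - delay N i).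
  rewrite /x/= in xd1 xd2.
  have td : t - r <= t - delay N i <= t by apply/andP; split; lra.
  have xd : `|ln (y i (t - delay N i)) - ln (w i (t - delay N i))| <= Q * f.
    by rewrite ler_norml; have := xd1 td; have := xd2 td => *; apply/andP; split; lra.
  have thB : th * om t * f <= bcoef N i t * Lam * f.
    rewrite ler_pM2r// [leRHS]mulrC.
    apply: ler_pM => //; first exact: ltW.
    by case: ck => _ /(_ t) /andP[/ltW].
  have := slope y dy i t ry ay Tt; have := slope w dw i t rw aw Tt.
  rewrite !ler_norml => /andP[sw1 sw2] /andP[sy1 sy2].
  rewrite /dx/=; case: b xf => /= xf.
    have := @log_ratio_contact M k Q y w i t f M0 k34 kM k1 Q0 kQ f0 fub
      (fun j => ry j t Tt') (fun j => rw j t Tt') (ry i _ Td) (rw i _ Td) xf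
      (fun j => xle (j, true)) xd.
    rewrite -/Lam; lra.
  have := @log_ratio_contact M k Q w y i t f M0 k34 kM k1 Q0 kQ f0 fub
    (fun j => rw j t Tt') (fun j => ry j t Tt') (rw i _ Td) (ry i _ Td) xf
    (fun j => xle (j, false)).
  rewrite distrC => /(_ xd); rewrite -/Lam; lra.
move=> i t Tt.
have := main (i, true) t Tt; have := main (i, false) t Tt; rewrite /x/=.
set bnd := C1 * _ * _ + _ => m1 m2.
have -> : ub * (C1 * (ub / M)) * expR (- c' * (t - T)) + ub * (C2 * (2 / M)) * e = ub * bnd.
  by rewrite /bnd; ring.
have diff (u v : R) : 0 < u -> 0 < v -> u <= ub -> 0 <= bnd -> ln u - ln v <= bnd ->
    u - v <= ub * bnd.
  move=> u0 v0 uub b0 uv; have /andP[_ H] := lnB_bounds u0 v0.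
  apply: le_trans H _; have [uv0|uv0] := leP 0 (ln u - ln v).
    by apply: ler_pM => //; exact: ltW.
  apply: (@le_trans _ _ 0); first by rewrite pmulr_rle0// ltW.
  by rewrite mulr_ge0// ltW.
have bnd0 : 0 <= bnd by lra.
have yub : y i t <= ub by apply: region_le_ub; [exact: y0|case: (ry i t Tt)].
have wub : w i t <= ub by apply: region_le_ub; [exact: w0|case: (rw i t Tt)].
have D1 := diff _ _ (y0 i t Tt) (w0 i t Tt) yub bnd0 m2.
have D2 := diff _ _ (w0 i t Tt) (y0 i t Tt) wub bnd0 m1.
by rewrite ler_norml; apply/andP; split; lra.
Qed.

(** With [e' = 0] it shows that a translate of a solution is an approximate solution; with [e' > 0]
    it passes the equation to the limit of translates. *)
Lemma rhs_perturbation (U : R) : 0 < U ->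
  exists2 K, 0 < K & forall y w i s t e e', 0 <= e -> 0 <= e' ->
  almost_period (coef N) e s ->
  (forall j, 0 <= y j (t + s) <= U /\ `|y j (t + s) - w j t| <= e') ->
  0 <= y i (t + s - delay N i) <= U -> 0 <= w i (t - delay N i) ->
  `|y i (t + s - delay N i) - w i (t - delay N i)| <= e' ->
  `|nicholson_rhs N y i (t + s) - nicholson_rhs N w i t| <= K * (e + e').
Proof.
move=> U0; pose K1 := U + B; have K10 : 0 < K1 by exact: addr_gt0.
pose K := K1 + m%:R * K1 + (K1 + B * (U * U)); exists K => [|y w i s t e e' e0 e'0 se].
  have : 0 <= m%:R * K1 by rewrite mulr_ge0// ltW.
  have : 0 < B * (U * U) by rewrite !mulr_gt0.
  rewrite /K; lra.
have lin (a a' u u' : R) : `|a' - a| <= e -> `|a| <= B -> 0 <= u' <= U -> `|u' - u| <= e' ->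
    `|a' * u' - a * u| <= K1 * (e + e').
  move=> ae aB /andP[u'0 u'U] ue.
  have -> : a' * u' - a * u = (a' - a) * u' + a * (u' - u) by ring.
  apply: le_trans (ler_normD _ _) _; rewrite !normrM (ger0_norm u'0).
  have h1 : `|a' - a| * u' <= e * U by apply: ler_pM.
  have h2 : `|a| * `|u' - u| <= B * e' by apply: ler_pM.
  have : 0 <= B * e by rewrite mulr_ge0// ltW.
  have : 0 <= U * e' by rewrite mulr_ge0// ltW.
  rewrite /K1; lra.
have AP k : `|coef N k (t + s) - coef N k t| <= e by exact/ltW/se.
move=> yw; rewrite /nicholson_rhs.
set v' := y i (t + s - delay N i); set v := w i (t - delay N i) => /andP[v'0 v'U] v0 vv.
set d' := dcoef N i (t + s); set d := dcoef N i t.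
set b' := bcoef N i (t + s); set b := bcoef N i t.
set c' := ccoef N i (t + s); set c := ccoef N i t.
have D : `|d' * y i (t + s) - d * w i t| <= K1 * (e + e').
  have [yU ye] := yw i; apply: lin => //; last exact: dcoef_le.
  exact: (AP (inr (inl i))).
have S : `|\sum_(j < m) acoef N i j (t + s) * y j (t + s) - \sum_(j < m) acoef N i j t * w j t|
    <= m%:R * K1 * (e + e').
  rewrite -sumrB; apply: le_trans (ler_norm_sum _ _ _) _.
  have -> : m%:R * K1 * (e + e') = \sum_(j < m) (K1 * (e + e')).
    by rewrite -mulrA mulr_natl sumr_const card_ord.
  apply: ler_sum => j _; have [yU ye] := yw j; apply: lin => //; last exact: acoef_le.
  exact: (AP (inl (i, j))).
have c'0 : 0 <= c' by exact/ltW/ccoef_gt0.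
have c00 : 0 <= c by exact/ltW/ccoef_gt0.
have bB : `|b| <= B by exact: bcoef_le_bound.
have G : `|b' * (v' * expR (- c' * v')) - b * (v * expR (- c * v))| <=
    (K1 + B * (U * U)) * (e + e').
  have -> : b' * (v' * expR (- c' * v')) - b * (v * expR (- c * v)) =
     (b' - b) * (v' * expR (- c' * v')) +
     (b * (v' * (expR (- (c' * v')) - expR (- (c * v')))) +
      b * (v' * expR (- c * v') - v * expR (- c * v))) by rewrite !mulNr; ring.
  have h1 : `|(b' - b) * (v' * expR (- c' * v'))| <= e * U.
    rewrite normrM; apply: ler_pM => //; first exact: (AP (inr (inr (inr i)))).
    rewrite ger0_norm ?mulr_ge0 ?expR_ge0// -[leRHS]mulr1; apply: ler_pM => //.
    by rewrite mulNr expRN_le1// mulr_ge0.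
  have h2 : `|b * (v' * (expR (- (c' * v')) - expR (- (c * v'))))| <= B * (U * (U * e)).
    rewrite !normrM (ger0_norm v'0); apply: ler_pM => //.
      by rewrite mulr_ge0.
    apply: ler_pM => //; apply: le_trans (expRN_lipschitz _ _) _; rewrite ?mulr_ge0//.
    rewrite -mulrBl normrM mulrC (ger0_norm v'0); apply: ler_pM => //.
    exact: (AP (inr (inr (inl i)))).
  have h3 : `|b * (v' * expR (- c * v') - v * expR (- c * v))| <= B * e'.
    rewrite normrM; apply: ler_pM => //; apply: le_trans vv; exact: ricker_lipschitz.
  apply: le_trans (ler_normD _ _) _; apply: le_trans (lerD h1 (ler_normD _ _)) _.
  apply: le_trans (lerD (lexx _) (lerD h2 h3)) _.
  have : 0 <= B * e by rewrite mulr_ge0// ltW.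
  have : 0 <= U * e' by rewrite mulr_ge0// ltW.
  have : 0 <= B * (U * U) * e' by rewrite !mulr_ge0// ltW.
  rewrite /K1; lra.
rewrite /K.
set Y1 := \sum_(j < m) _ in S *; set Y2 := \sum_(j < m) _ in S *.
have -> : - d' * y i (t + s) + Y1 + b' * v' * expR (- c' * v') -
    (- d * w i t + Y2 + b * v * expR (- c * v)) =
  - (d' * y i (t + s) - d * w i t) + ((Y1 - Y2) +
   (b' * (v' * expR (- c' * v')) - b * (v * expR (- c * v)))) by ring.
apply: le_trans (ler_normD _ _) _; rewrite normrN.
apply: le_trans (lerD D (ler_normD _ _)) _.
apply: le_trans (lerD (lexx _) (lerD S G)) _; lra.
Qed.

Lemma rhs_bounded (U : R) : 0 < U ->
  exists2 K, 0 < K & forall y i t, (forall j, 0 <= y j t <= U) ->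
  0 <= y i (t - delay N i) <= U -> `|nicholson_rhs N y i t| <= K.
Proof.
move=> U0; exists (B * U + m%:R * (B * U) + B * U) => [|y i t yU /andP[v0 vU]].
  have BU : 0 < B * U by exact: mulr_gt0.
  by have : 0 <= m%:R * (B * U) by [rewrite mulr_ge0// ltW]; lra.
rewrite /nicholson_rhs; set v := y i _ in v0 vU *.
have cv0 : 0 <= ccoef N i t * v by rewrite mulr_ge0// ltW// ccoef_gt0.
apply: le_trans (ler_normD _ _) _; apply: lerD; first apply: le_trans (ler_normD _ _) _;
  first apply: lerD.
- have /andP[y0 yUi] := yU i; rewrite normrM normrN (ger0_norm y0).
  by apply: ler_pM => //; exact: dcoef_le.
- apply: le_trans (ler_norm_sum _ _ _) _.
  have -> : m%:R * (B * U) = \sum_(j < m) (B * U) by rewrite sumr_const card_ord mulr_natl.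
  apply: ler_sum => j _; have /andP[y0 yUj] := yU j.
  by rewrite normrM (ger0_norm y0); apply: ler_pM => //; exact: acoef_le.
- rewrite !normrM (ger0_norm v0) (ger0_norm (expR_ge0 _)) -[leRHS]mulr1 mulNr.
  apply: ler_pM; rewrite ?mulr_ge0 ?expR_ge0 ?expRN_le1//.
  by apply: ler_pM => //; exact: bcoef_le_bound.
Qed.

(** * From one solution in the region to an almost periodic solution *)

Section AsymptoticallyAlmostPeriodic.
Variables (y : 'I_m -> R -> R) (M T : R).
Hypothesis M_gt0 : 0 < M.
Hypothesis y_region : region M y T.
Hypothesis dy : forall i t, T <= t -> is_derive t 1 (y i) (nicholson_rhs N y i t).

Let ub_gt0 : 0 < ub. Proof. by rewrite /ub divr_gt0// mulr_gt0. Qed.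

Let y_bounds i t : T <= t -> 0 <= y i t <= ub.
Proof.
move=> Tt; have [yM y7] := y_region i Tt.
have y0 : 0 < y i t by exact: lt_le_trans yM.
by rewrite (ltW y0) region_le_ub.
Qed.

(** The solution merges with its own translate by [v - u], whose defect is at most [K * e]. Ordering
    [u <= v] makes the translation forward, so the translate stays in the region from [T] on. *)
Lemma solution_asymptotic_period (eps : R) : 0 < eps ->
  exists e tau, [/\ 0 < e, T <= tau & forall u v i, tau <= u -> tau <= v ->
    almost_period (coef N) e (v - u) -> `|y i v - y i u| <= eps].
Proof.
move=> eps0.
have [C1 [C2 [c' [C10 C20 c'0 merge]]]] := approx_solutions_merge M_gt0.
have [K K0 perturb] := rhs_perturbation ub_gt0.
have eps20 : 0 < eps / 2 by lra.
have [s s0 Hs] := exp_decay_eventually_le (ltW C10) c'0 eps20.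
have e0 : 0 < eps / (2 * (C2 * K)) by rewrite divr_gt0// !mulr_gt0.
have r0 := total_delay_ge0.
exists (eps / (2 * (C2 * K))), (T + s); split => //; first by rewrite lerDl.
move=> u v i; wlog uv : u v / u <= v => [H tu tv au|tu tv au].
  have [uv|/ltW vu] := leP u v; first exact: H.
  rewrite distrC; apply: H => //.
  by rewrite -opprB; exact: almost_periodN.
have vE : v = u + (v - u) by ring.
set e := eps / _ in e0 au.
have shift t : T <= t -> T <= t + (v - u) by lra.
have H := merge y (fun j t => y j (t + (v - u))) (nicholson_rhs N y)
  (fun j t => nicholson_rhs N y j (t + (v - u))) T (K * e).
have : `|y i u - y i (u + (v - u))| <= C1 * expR (- c' * (u - T)) + C2 * (K * e).
  apply: H => //.
  - by rewrite mulr_ge0// ltW.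
  - by move=> j t Tt; apply: y_region; exact: shift.
  - move=> j t Tt; split => [|_]; first exact: dy.
    by rewrite subrr normr0 mulr_ge0// ltW.
  - move=> j t Tt; split.
      by apply: is_derive_translate; apply: dy; exact: shift.
    move=> Trt; have dl := delay_le j; have dp := delay_gt0 j.
    have := perturb y (fun j t => y j (t + (v - u))) j (v - u) t e 0 (ltW e0) (lexx 0) au.
    rewrite addr0; apply => //.
    + move=> k; split; last by rewrite subrr normr0.
      by apply: y_bounds; exact: shift.
    + by apply: y_bounds; lra.
    + have : T <= t - delay N j + (v - u) by lra.
      by move=> /(y_bounds j) /andP[].
    + by have -> : t - delay N j + (v - u) = t + (v - u) - delay N j;
        [ring|rewrite subrr normr0].
  - lra.
have : C1 * expR (- c' * (u - T)) <= eps / 2 by apply: Hs; lra.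
have -> : C2 * (K * e) = eps / 2 by rewrite /e; field; rewrite !gt_eqF.
rewrite -vE distrC; lra.
Qed.

Let s_exists : exists s : nat -> R, forall n, n%:R <= s n /\
  almost_period (coef N) (n.+1%:R^-1) (s n).
Proof.
have /choice [s sP] n : exists s : R, n%:R <= s /\ almost_period (coef N) (n.+1%:R^-1) s.
  have n0 : 0 < (n.+1%:R)^-1 :> R by rewrite invr_gt0.
  have [l l0 Hl] := common_almost_periods apN n0.
  by have [s sP /andP[ns _]] := Hl n%:R; exists s.
by exists s.
Qed.

Let index_large (A : R) : exists n : nat, A <= n%:R.
Proof. by exists (Num.truncn A).+1; apply: ltW; rewrite truncnS_gt. Qed.

Let index_inv (e : R) : 0 < e -> exists n0 : nat, forall n, (n0 <= n)%N -> n.+1%:R^-1 <= e.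
Proof.
move=> e0; have [n0 Hn0] := index_large e^-1; exists n0 => n nn0.
rewrite -[leRHS]invrK lef_pV2 ?posrE ?invr_gt0//; apply: le_trans Hn0 _.
by rewrite ler_nat ltnW.
Qed.

Lemma limit_along_almost_periods : exists (s : nat -> R) p,
  [/\ forall n, n%:R <= s n,
      forall e, 0 < e -> exists n0, forall n, (n0 <= n)%N -> almost_period (coef N) e (s n)
    & forall A eps, 0 < eps -> exists n0, forall n i t, (n0 <= n)%N -> A <= t ->
        `|y i (t + s n) - p i t| <= eps].
Proof.
have [s sP] := s_exists; exists s.
have sn n : n%:R <= s n by case: (sP n).
have sap e : 0 < e -> exists n0, forall n, (n0 <= n)%N -> almost_period (coef N) e (s n).
  move=> e0; have [n0 Hn0] := index_inv e0; exists n0 => n nn0.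
  by have [_ an] := sP n; exact: almost_periodW (Hn0 n nn0) an.
have cauchy A eps : 0 < eps -> exists n0, forall n k i t, (n0 <= n)%N -> (n0 <= k)%N ->
    A <= t -> `|y i (t + s n) - y i (t + s k)| <= eps.
  move=> eps0; have [e [tau [e0 Ttau H]]] := solution_asymptotic_period eps0.
  have e20 : 0 < e / 2 by lra.
  have [n1 Hn1] := sap _ e20; have [n2 Hn2] := index_large (tau - A).
  exists (maxn n1 n2) => n k i t; rewrite !geq_max => /andP[n1n n2n] /andP[n1k n2k] At.
  have far q : (n2 <= q)%N -> tau <= t + s q.
    move=> n2q; have := sn q; have : n2%:R <= q%:R :> R by rewrite ler_nat.
    lra.
  apply: H; [exact: far|exact: far|].
  have -> : t + s n - (t + s k) = s n - s k by ring.
  by rewrite [e]splitr; apply: almost_periodB; [exact: Hn1|exact: Hn1].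
have /choice [q qP] (it : 'I_m * R) : exists l, forall e n0,
    (forall n k, (n0 <= n)%N -> (n0 <= k)%N ->
     `|y it.1 (it.2 + s n) - y it.1 (it.2 + s k)| <= e) ->
    forall n, (n0 <= n)%N -> `|y it.1 (it.2 + s n) - l| <= e.
  apply: cauchy_limit => e e0; have [n0 Hn0] := cauchy it.2 e e0.
  by exists n0 => n k nn nk; exact: Hn0.
exists (fun i t => q (i, t)); split => // A eps eps0.
have [n0 Hn0] := cauchy A eps eps0; exists n0 => n i t nn0 At.
by apply: (qP (i, t) eps n0) => // a b na nb; exact: Hn0.
Qed.

(** Common almost periods of the coefficients become almost periods of the limit. The derivative is
    found by comparing the increment of [p] over [h] with that of a translate of [y], whose slope is
    close to the right-hand side for [p]. *)
Lemma ap_solution_exists : exists p, positive_ap_solution N p.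
Proof.
have [s [p [sn sap plim]]] := limit_along_almost_periods; exists p.
have far (A : R) : exists n0, forall n, (n0 <= n)%N -> A <= s n.
  have [n0 Hn0] := index_large A; exists n0 => n nn0.
  by apply: le_trans (sn n); apply: le_trans Hn0 _; rewrite ler_nat.
have pM i t : M <= p i t.
  rewrite leNgt; apply/negP => pM.
  have eps0 : 0 < (M - p i t) / 2 by lra.
  have [n1 Hn1] := plim t _ eps0; have [n2 Hn2] := far (T - t).
  have := Hn1 (maxn n1 n2) i t (leq_maxl _ _) (lexx _).
  have : T <= t + s (maxn n1 n2) by have := Hn2 _ (leq_maxr n1 n2); lra.
  move=> /(y_region i) [yM _]; rewrite ler_norml => /andP[_]; lra.
have pap eps : 0 < eps -> exists2 e, 0 < e & forall u i t,
    almost_period (coef N) e u -> `|p i (t + u) - p i t| < eps.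
  move=> eps0; have eps40 : 0 < eps / 4 by lra.
  have [e [tau [e0 Ttau H]]] := solution_asymptotic_period eps40.
  exists e => // u i t eu.
  have [n1 Hn1] := plim (Num.min t (t + u)) _ eps40.
  have [n2 Hn2] := far (tau - t); have [n3 Hn3] := far (tau - (t + u)).
  pose n := maxn n1 (maxn n2 n3).
  have /Hn2 f2 : (n2 <= n)%N by rewrite /n !leq_max leqnn !orbT.
  have /Hn3 f3 : (n3 <= n)%N by rewrite /n !leq_max leqnn !orbT.
  have n1n : (n1 <= n)%N by exact: leq_maxl.
  have := Hn1 n i t n1n; have := Hn1 n i (t + u) n1n.
  rewrite !ge_min !lexx orbT => /(_ isT) h1 /(_ isT) h2.
  have h3 : `|y i (t + u + s n) - y i (t + s n)| <= eps / 4.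
    apply: H; [lra|lra|].
    by have -> : t + u + s n - (t + s n) = u by ring.
  move: h1 h2 h3; rewrite !ler_norml ltr_norml.
  by move=> /andP[? ?] /andP[? ?] /andP[? ?]; apply/andP; split; lra.
have [K K0 perturb] := rhs_perturbation ub_gt0.
have [L L0 rhsL] := rhs_bounded ub_gt0.
have r0 := total_delay_ge0.
have ylip i u v : T + r <= u -> T + r <= v -> `|y i v - y i u| <= L * `|v - u|.
  move=> Tu Tv.
  wlog uv : u v Tu Tv / u <= v => [H|].
    have [uv|/ltW vu] := leP u v; first exact: H.
    by rewrite distrC [`|v - u|]distrC; exact: H.
  have dT t : u <= t <= v -> is_derive t 1 (y i) (nicholson_rhs N y i t).
    by move=> /andP[ut tv]; apply: dy; lra.
  have bT t : u <= t <= v -> `|nicholson_rhs N y i t| <= L.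
    move=> /andP[ut tv]; have := delay_le i; have := delay_gt0 i => d1 d2.
    by apply: rhsL => [j|]; apply: y_bounds; lra.
  rewrite [`|v - u|]ger0_norm ?subr_ge0// ler_norml -mulNr; apply/andP; split.
    apply: (derive_ge_increment uv dT) => t /bT.
    by rewrite ler_norml => /andP[].
  apply: (derive_le_increment uv dT) => t /bT.
  by rewrite ler_norml => /andP[].
have dp i (t : R) : is_derive t 1 (p i) (nicholson_rhs N p i t).
  apply/is_deriveP => eps eps0.
  pose f := eps / (2 * K) / 2; have f0 : 0 < f by rewrite !divr_gt0// mulr_gt0.
  have Kf : K * (f + f) = eps / 2 by rewrite /f; field; rewrite gt_eqF.
  have f20 : 0 < f / 2 by lra.
  have [d d0 near0] := almost_period_near0 apN f20.
  pose d' := Num.min d (Num.min 1 (f / 2 / L)).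
  have d'0 : 0 < d' by rewrite !lt_min d0 ltr01 divr_gt0.
  exists d' => // h; rewrite !lt_min => /and3P[hd h1 hL].
  have [->|h0] := eqVneq h 0; first by rewrite addr0 mul0r !subrr normr0 mulr0.
  have nh0 : 0 < `|h| by rewrite normr_gt0.
  (* The index [n] may depend on [h]: replacing [p] by a translate at both ends costs at most
     [2 * g <= eps / 2 * |h|], and the slope error accounts for the other half. *)
  pose g := Num.min (eps / 4 * `|h|) (f / 2).
  have g0 : 0 < g by rewrite lt_min f20 andbT mulr_gt0//; lra.
  have gh : g <= eps / 4 * `|h| by rewrite ge_min lexx.
  have gf : g <= f / 2 by rewrite ge_min lexx orbT.
  have [n1 Hn1] := plim (t - r - 1) g g0.
  have [n2 Hn2] := far (T + r + r + 1 - t).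
  have [n3 Hn3] := sap _ f20.
  pose n := maxn n1 (maxn n2 n3).
  have n1n : (n1 <= n)%N by exact: leq_maxl.
  have /Hn2 sT : (n2 <= n)%N by rewrite /n !leq_max leqnn !orbT.
  have /Hn3 sA : (n3 <= n)%N by rewrite /n !leq_max leqnn !orbT.
  have close j u : t - r - 1 <= u -> `|y j (u + s n) - p j u| <= g by exact: Hn1.
  have rd := delay_le i; have rp := delay_gt0 i.
  have slope u : `|u - t| <= `|h| ->
      `|nicholson_rhs N y i (u + s n) - nicholson_rhs N p i t| <= eps / 2.
    move=> uh.
    have ut : `|u - t| < 1 by exact: le_lt_trans uh h1.
    (* The small displacement [u - t] is itself an almost period, so it is absorbed into the shift
       and the right-hand side for [p] is evaluated at [t] alone. *)
    have uE : u + s n = t + (s n + (u - t)) by ring.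
    have shift j v : t - r <= v <= t ->
        0 <= y j (v + (s n + (u - t))) <= ub /\
        `|y j (v + (s n + (u - t))) - p j v| <= f.
      move=> /andP[vr vt]; move: (ut); rewrite ltr_norml => /andP[u1 u2].
      split; first by apply: y_bounds; lra.
      have e1 : `|y j (v + (s n + (u - t))) - y j (v + s n)| <= L * `|u - t|.
        have -> : u - t = v + (s n + (u - t)) - (v + s n) by ring.
        have -> : v + (s n + (v + (s n + (u - t)) - (v + s n))) = v + (s n + (u - t)) by ring.
        by apply: ylip; lra.
      have e2 : L * `|u - t| <= f / 2.
        rewrite mulrC -ler_pdivlMr//; apply: le_trans uh _; exact: ltW.
      have e3 : `|y j (v + s n) - p j v| <= f / 2 by apply: le_trans (close _ _ _) gf; lra.
      have -> : y j (v + (s n + (u - t))) - p j v =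
        (y j (v + (s n + (u - t))) - y j (v + s n)) + (y j (v + s n) - p j v) by ring.
      by apply: le_trans (ler_normD _ _) _; lra.
    rewrite uE -Kf; apply: perturb; rewrite ?(ltW f0)//.
    - have -> : f = f / 2 + f / 2 by field.
      have -> : s n + (u - t) = s n - (t - u) by ring.
      apply: almost_periodB => //; apply: near0; rewrite distrC.
      exact: le_lt_trans uh hd.
    - by move=> j; apply: shift; rewrite lexx andbT; lra.
    - have -> : t + (s n + (u - t)) - delay N i = t - delay N i + (s n + (u - t)) by ring.
      by have [] := shift i (t - delay N i) _ => //; apply/andP; split; lra.
    - by apply: le_trans (pM i _); exact: ltW.
    - have -> : t + (s n + (u - t)) - delay N i = t - delay N i + (s n + (u - t)) by ring.
      by have [] := shift i (t - delay N i) _ => //; apply/andP; split; lra.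
  pose l := nicholson_rhs N p i t.
  pose Z u := y i (u + s n) - u * l.
  have dZ (u : R) : `|u - t| <= `|t + h - t| ->
      is_derive u 1 Z (nicholson_rhs N y i (u + s n) - l).
    rewrite addrAC subrr add0r => uh.
    have ut : `|u - t| < 1 by exact: le_lt_trans uh h1.
    have ? : is_derive u 1 (fun v => y i (v + s n)) (nicholson_rhs N y i (u + s n)).
      apply: is_derive_translate; apply: dy.
      by move: ut; rewrite ltr_norml => /andP[u1 u2]; lra.
    have -> : Z = (fun v => y i (v + s n)) - (l \*: id).
      by apply/funext => v; rewrite /Z !fctE mulrC.
    apply: is_derive_eq; congr (_ - _); exact: mulr1.
  have : `|Z (t + h) - Z t| <= eps / 2 * `|t + h - t|.
    apply: derive_abs_increment dZ _ => u; rewrite addrAC subrr add0r; exact: slope.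
  have thE : t + h - t = h by ring.
  rewrite thE /Z => Zle.
  have ht : t - r - 1 <= t + h by move: h1; rewrite ltr_norml => /andP[? ?]; lra.
  have a1 := close i (t + h) ht.
  have a2 := close i t (ltac:(lra)).
  have -> : p i (t + h) - p i t - h * l =
    (y i (t + h + s n) - (t + h) * l - (y i (t + s n) - t * l)) -
    ((y i (t + h + s n) - p i (t + h)) - (y i (t + s n) - p i t)) by ring.
  apply: le_trans (ler_normB _ _) _; apply: le_trans (lerD Zle (ler_normB _ _)) _.
  apply: le_trans (lerD (lexx _) (lerD a1 a2)) _; lra.
split => // i; last by move=> t; exact: lt_le_trans (pM i t).
split; first by move=> t; exact: is_derive_continuous (dp i t).
move=> eps eps0; have [e e0 He] := pap eps eps0.
have [l l0 Hl] := common_almost_periods apN e0; exists l => // x.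
by have [u ue xu] := Hl x; exists u => // t; exact: He.
Qed.

End AsymptoticallyAlmostPeriodic.

(** * Exponential attraction and uniqueness *)

Section Persistence.
Variable M : R.
Hypothesis M_gt0 : 0 < M.
Hypothesis persistent : forall phi y, in_state_space N phi -> state_ge0 N phi ->
  (forall i, 0 < phi i 0) -> solution_from N phi y ->
  exists2 t0 : R, 0 <= t0 & forall t i, t0 <= t -> M <= y i t.

(** Stated for every later [T], so that two solutions can be compared from a common time. *)
Lemma solution_eventually_in_region phi y :
  in_state_space N phi -> state_ge0 N phi -> (forall i, 0 < phi i 0) ->
  solution_from N phi y -> exists T0, forall T, T0 <= T ->
    [/\ 0 < T, region M y T &
      forall i t, T <= t -> is_derive t 1 (y i) (nicholson_rhs N y i t)].
Proof.
move=> phic phi0 phip sol; have [t0 _ Ht0] := persistent phic phi0 phip sol.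
have [_ _ _ dy] := sol.
have [|T' T'1 HT'] := @eventually_le_upper_bound y 1.
  by move=> i t t1; apply: dy; lra.
exists (Num.max t0 T') => T; rewrite ge_max => /andP[t0T T'T]; split; first lra.
  by move=> i t Tt; split; [apply: Ht0; lra|apply: HT'; lra].
by move=> i t Tt; apply: dy; lra.
Qed.

Lemma state_norm_le (f : 'I_m -> R -> R) b : 0 <= b ->
  (forall i s, - delay N i <= s <= 0 -> `|f i s| <= b) -> state_norm N f <= b.
Proof.
move=> b0 fb; rewrite /state_norm; set S := [set x | _].
(* The set is empty when [m = 0], and [sup] then has the default value 0. *)
have [->|/set0P S0] := eqVneq S set0; first by rewrite sup0.
by apply: ge_sup => // _ [i [s sr ->]]; exact: fb.
Qed.

Lemma solutions_attract_exponentially phi psi y p :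
  in_state_space N phi -> state_ge0 N phi -> (forall i, 0 < phi i 0) ->
  solution_from N phi y ->
  in_state_space N psi -> state_ge0 N psi -> (forall i, 0 < psi i 0) ->
  solution_from N psi p -> attracts_exponentially N p y.
Proof.
move=> phic phi0 phip soly psic psi0 psip solp.
have [T1 H1] := solution_eventually_in_region phic phi0 phip soly.
have [T2 H2] := solution_eventually_in_region psic psi0 psip solp.
pose T := Num.max T1 T2.
have [|T0 ry dy] := H1 T; first by rewrite le_max lexx.
have [|_ rp dp] := H2 T; first by rewrite le_max lexx orbT.
have [C1 [C2 [c' [C10 C20 c'0 merge]]]] := approx_solutions_merge M_gt0.
have r0 := total_delay_ge0.
have exact_solution z : (forall i t, T <= t -> is_derive t 1 (z i) (nicholson_rhs N z i t)) ->
    approx_solution 0 z (nicholson_rhs N z) T.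
  by move=> dz i t Tt; split => [|_]; [exact: dz|rewrite subrr normr0].
have late i t : T <= t -> `|y i t - p i t| <= C1 * expR (- c' * (t - T)).
  move=> Tt; rewrite -[leRHS]addr0 -(mulr0 C2).
  by apply: (merge y p _ _ T 0) Tt => //; exact: exact_solution.
have [b b0 early] : exists2 b, 0 < b &
    forall i t, - delay N i <= t <= T -> `|y i t - p i t| <= b.
  have bounded_on (q : 'I_m -> R -> R) i : {within `[- delay N i, +oo[, continuous (q i)} ->
      exists b, 0 < b /\ forall t, - delay N i <= t <= T -> `|q i t| <= b.
    move=> cq; have [|b b0 Hb] := @within_continuous_bounded R (q i) (- delay N i) T.
      apply: continuous_subspaceW cq => t /=; rewrite !in_itv/= andbT.
      by move=> /andP[].
    by exists b.
  have /choice [by_ byP] i : exists b, 0 < b /\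
      forall t, - delay N i <= t <= T -> `|y i t| <= b.
    by apply: bounded_on; case: soly.
  have /choice [bp bpP] i : exists b, 0 < b /\
      forall t, - delay N i <= t <= T -> `|p i t| <= b.
    by apply: bounded_on; case: solp.
  have b0 i : 0 <= by_ i + bp i by case: (byP i) (bpP i) => ? _ [? _]; lra.
  exists (1 + \sum_i (by_ i + bp i)) => [|i t tT].
    have : 0 <= \sum_i (by_ i + bp i) by exact: sumr_ge0.
    lra.
  have [_ /(_ t tT) h1] := byP i; have [_ /(_ t tT) h2] := bpP i.
  apply: le_trans (ler_normB _ _) _; rewrite (bigD1 i)//=.
  have : 0 <= \sum_(j | j != i) (by_ j + bp j) by exact: sumr_ge0.
  lra.
(* The segment at time [t] reaches back at most to [t - r], and [b] covers the times before [T];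
   both are paid for by enlarging the constant. *)
pose C := (C1 + b) * expR (c' * (T + r)).
have C0 : 0 < C by rewrite /C mulr_gt0 ?expR_gt0 ?addr_gt0.
exists C, c'; split => // t t0.
have CE : C * expR (- c' * t) = (C1 + b) * expR (c' * (T + r - t)).
  by rewrite /C -mulrA -expRD; congr (_ * expR _); ring.
apply: state_norm_le => [|i s /andP[s1 s2]]; first by rewrite mulr_ge0 ?expR_ge0 ?ltW.
have rd := delay_le i; rewrite /segment CE.
have [Tts|tsT] := leP T (t + s).
  apply: le_trans (late i _ Tts) _; apply: ler_pM => //; rewrite ?expR_ge0 ?(ltW C10)//.
    by rewrite lerDl ltW.
  rewrite ler_expR mulNr -mulrN ler_pM2l//; lra.
apply: (@le_trans _ _ b); first by apply: early; apply/andP; split; lra.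
rewrite -[leLHS]mulr1; apply: ler_pM => //; rewrite ?(ltW b0)//.
  by rewrite lerDr ltW.
by rewrite -expR0 ler_expR mulr_ge0 ?(ltW c'0)//; lra.
Qed.

(** An almost periodic solution starts from its own initial segment, so persistence and merging
    apply to it. *)
Lemma ap_solution_from p : positive_ap_solution N p ->
  [/\ in_state_space N p, state_ge0 N p, forall i, 0 < p i 0 & solution_from N p p].
Proof.
move=> [app p0 dp].
have cp i : continuous (p i) by case: (app i).
split=> //; first by move=> i; exact: continuous_subspaceT.
  by move=> i s _; exact: ltW.
split=> //; first by move=> i; exact: continuous_subspaceT.
by move=> i; have := is_derive_at_right (dp i 0); under eq_fun do rewrite add0r.
Qed.

(** The two solutions merge as time grows, yet a difference at [t] recurs, up to small errors, at
    [t + u] for arbitrarily late common almost periods [u]. *)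
Lemma ap_solution_unique p q :
  positive_ap_solution N p -> positive_ap_solution N q -> p = q.
Proof.
move=> pp pq.
have [cp p0 p00 sp] := ap_solution_from pp; have [cq q0 q00 sq] := ap_solution_from pq.
have [T1 H1] := solution_eventually_in_region cp p0 p00 sp.
have [T2 H2] := solution_eventually_in_region cq q0 q00 sq.
pose T := Num.max T1 T2.
have [|T0 rp dp] := H1 T; first by rewrite le_max lexx.
have [|_ rq dq] := H2 T; first by rewrite le_max lexx orbT.
have [C1 [C2 [c' [C10 C20 c'0 merge]]]] := approx_solutions_merge M_gt0.
apply/funext => i; apply/funext => t; apply/eqP; rewrite -subr_eq0 -normr_le0.
rewrite leNgt; apply/negP => d0; set d := `|p i t - q i t| in d0.
have d40 : 0 < d / 4 by lra.
have [s s0 Hs] := exp_decay_eventually_le (ltW C10) c'0 d40.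
have [app _ _] := pp; have [apq _ _] := pq.
have [|l l0 Hl] := @common_almost_periods R bool (fun b => if b then p i else q i) _ _ d40.
  by case.
have [u uP /andP[u1 _]] := Hl (T + s - t).
have Tu : T <= t + u by lra.
have := merge p q (nicholson_rhs N p) (nicholson_rhs N q) T 0 (lexx 0) rp rq.
have r0 := total_delay_ge0.
move=> /(_ _ _ i _ Tu)/wrap[||].
- by move=> j v Tv; split => [|_]; [exact: dp|rewrite subrr normr0].
- by move=> j v Tv; split => [|_]; [exact: dq|rewrite subrr normr0].
rewrite mulr0 addr0 => H.
have Hd : C1 * expR (- c' * (t + u - T)) <= d / 4 by apply: Hs; lra.
have hp := uP true t; have hq := uP false t; rewrite /= in hp hq.
have dE : d <= `|p i (t + u) - q i (t + u)| +
    (`|p i (t + u) - p i t| + `|q i (t + u) - q i t|).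
  rewrite /d; have -> : p i t - q i t = (p i (t + u) - q i (t + u)) -
    ((p i (t + u) - p i t) - (q i (t + u) - q i t)) by ring.
  by apply: le_trans (ler_normB _ _) _; rewrite lerD2l ler_normB.
lra.
Qed.

End Persistence.

(** * Existence of one positive solution *)

Let truncated_rhs y i t : R :=
  - dcoef N i t * y i t + \sum_(j < m) acoef N i j t * y j t +
  bcoef N i t * (Num.max (y i (t - delay N i)) 0 *
    expR (- ccoef N i t * Num.max (y i (t - delay N i)) 0)).

Let lip : R := B + m%:R * B + B.

Let lip_gt0 : 0 < lip.
Proof.
have mB : 0 <= m%:R * B by rewrite mulr_ge0// ltW.
by rewrite /lip; have := B_gt0; lra.
Qed.

(** Replacing the delayed value by its positive part avoids the exponential growth of the Ricker
    term at negative arguments, whence a global Lipschitz constant. *)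
Let truncated_rhs_lipschitz y w i t (A : R) :
  (forall j, `|y j t - w j t| <= A) ->
  `|y i (t - delay N i) - w i (t - delay N i)| <= A ->
  `|truncated_rhs y i t - truncated_rhs w i t| <= lip * A.
Proof.
move=> yw vv; rewrite /truncated_rhs.
set v := y i (t - delay N i) in vv *; set v' := w i (t - delay N i) in vv *.
have mulle (a u : R) : `|a| <= B -> `|u| <= A -> `|a * u| <= B * A.
  by move=> aB uA; rewrite normrM; apply: ler_pM.
set Y1 := \sum_(j < m) _; set Y2 := \sum_(j < m) _.
set F1 := _ * expR _; set F2 := _ * expR _.
have -> : - dcoef N i t * y i t + Y1 + bcoef N i t * F1 -
    (- dcoef N i t * w i t + Y2 + bcoef N i t * F2) =
  - (dcoef N i t * (y i t - w i t)) + ((Y1 - Y2) + bcoef N i t * (F1 - F2)) by ring.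
have D : `|dcoef N i t * (y i t - w i t)| <= B * A by apply: mulle => //; exact: dcoef_le.
have S : `|Y1 - Y2| <= m%:R * B * A.
  rewrite /Y1 /Y2 -sumrB; apply: le_trans (ler_norm_sum _ _ _) _.
  have -> : m%:R * B * A = \sum_(j < m) (B * A).
    by rewrite -mulrA mulr_natl sumr_const card_ord.
  by apply: ler_sum => j _; rewrite -mulrBr; apply: mulle => //; exact: acoef_le.
have F : `|bcoef N i t * (F1 - F2)| <= B * A.
  apply: mulle; first exact: bcoef_le_bound.
  apply: le_trans vv; apply: le_trans (dist_max0_le _ _).
  by apply: ricker_lipschitz; rewrite ?le_max ?lexx ?orbT// ltW ?ccoef_gt0.
apply: le_trans (ler_normD _ _) _; rewrite normrN.
apply: le_trans (lerD D (ler_normD _ _)) _.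
apply: le_trans (lerD (lexx _) (lerD S F)) _; rewrite /lip; lra.
Qed.

Let truncated_rhs_continuous y : (forall i, continuous (y i)) ->
  forall i, continuous (fun s => truncated_rhs y i (Num.max s 0)).
Proof.
move=> cy i; apply: (@continuous_compose_max0 R (truncated_rhs y i)) => t.
have ccoef_cont k : {for t, continuous (coef N k)} by case: (apN k) => + _; apply.
have cyd : {for t, continuous (fun s => Num.max (y i (s - delay N i)) 0)}.
  apply: continuous_max; last exact: cst_continuous.
  apply: (@continuous_comp _ _ _ (fun s : R => s - delay N i) (y i)); last exact: cy.
  by apply: cvgB; [exact: cvg_id|exact: cvg_cst].
apply: cvgD; first apply: cvgD.
- apply: cvgM; last exact: cy.
  by apply: cvgN; exact: (ccoef_cont (inr (inl i))).
- apply: continuous_sum => j; apply: cvgM; last exact: cy.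
  exact: (ccoef_cont (inl (i, j))).
- apply: cvgM; first exact: (ccoef_cont (inr (inr (inr i)))).
  apply: cvgM; first exact: cyd.
  apply: (@continuous_comp _ _ _
    (fun s : R => - ccoef N i s * Num.max (y i (s - delay N i)) 0) expR).
    apply: cvgM; last exact: cyd.
    by apply: cvgN; exact: (ccoef_cont (inr (inr (inl i)))).
  exact: continuous_expR.
Qed.

(* Picard iteration in the norm weighted by [exp (2 * lip * t)], for which the
   integral operator contracts by a factor 1/2; functions are extended to
   negative times by their value at 0. *)
Let truncated_solution_exists : exists y P,
  [/\ forall i, continuous (y i), forall i, P i 0 = 0,
      forall i (t : R), is_derive t 1 (P i) (truncated_rhs y i (Num.max t 0))
    & forall i t, y i t = 1 + P i (Num.max t 0)].
Proof.
have /choice [prim primP] (g : R -> R) : exists G : R -> R, continuous g ->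
    G 0 = 0 /\ forall t : R, is_derive t 1 G (g t).
  have [/primitive_exists [G HG]|ng] := pselect (continuous g); first by exists G.
  by exists g.
pose P y i := prim (fun s => truncated_rhs y i (Num.max s 0)).
pose step y i t : R := 1 + P y i (Num.max t 0).
have PP y i : (forall i, continuous (y i)) -> P y i 0 = 0 /\
    forall t : R, is_derive t 1 (P y i) (truncated_rhs y i (Num.max t 0)).
  by move=> cy; apply: primP; exact: truncated_rhs_continuous.
have cstep y : (forall i, continuous (y i)) -> forall i, continuous (step y i).
  move=> cy i; have [_ dP] := PP y i cy.
  apply: (@continuous_compose_max0 R (fun t => 1 + P y i t)) => t.
  apply: cvgD; first exact: cvg_cst.
  exact: is_derive_continuous (dP t).
pose lam := 2 * lip; have lam0 : 0 < lam by have := lip_gt0; rewrite /lam; lra.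
pose E t := expR (lam * Num.max t 0).
have dE (A s : R) : is_derive s 1 (fun u => A / 2 * expR (lam * u)) (lip * A * expR (lam * s)).
  have -> : (fun u => A / 2 * expR (lam * u)) = A / 2 \*: (expR \o (lam \*: id)).
    by apply/funext => u; rewrite !fctE.
  have D : is_derive s 1 (expR \o (lam \*: id)) (expR (lam * s) * (lam *: 1)).
    by apply: is_derive1_comp.
  apply: is_derive_eq.
  have sE (a b : R) : a *: b = a * b by [].
  by rewrite !sE /lam; field.
have growth (f df : R -> R) (A t : R) : 0 <= A ->
    (forall s : R, 0 <= s -> is_derive s 1 f (df s)) -> f 0 = 0 ->
    (forall s, 0 <= s -> `|df s| <= lip * A * expR (lam * s)) -> 0 <= t ->
    `|f t| <= A / 2 * expR (lam * t).
  move=> A0 df_ f0 dfle t0.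
  have E0 : 0 <= A / 2 * expR (lam * 0) by rewrite mulr_ge0 ?expR_ge0//; lra.
  have up := @derive_increment_dominated R f df _ _ 0 t t0 _ (fun s _ => dE A s).
  have dn := @derive_increment_dominated R (- f) (- df) _ _ 0 t t0 _ (fun s _ => dE A s).
  rewrite f0 !fctE f0 in up dn.
  have {}up := up (fun s H => df_ s (proj1 (andP H)))
    (fun s H => le_trans (ler_norm _) (dfle s (proj1 (andP H)))).
  have {}dn : - f t - - 0 <= A / 2 * expR (lam * t) - A / 2 * expR (lam * 0).
    apply: dn => s /andP[s0 _]; first by have := df_ s s0 => ?; exact: is_deriveN.
    by apply: le_trans (ler_norm _) _; rewrite normrN; exact: dfle.
  by rewrite ler_norml; apply/andP; split; lra.
have contract y w (A : R) : 0 <= A -> (forall i, continuous (y i)) ->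
    (forall i, continuous (w i)) ->
    (forall i t, `|y i t - w i t| <= A * E t) ->
    forall i t, `|step y i t - step w i t| <= A / 2 * E t.
  move=> A0 cy cw yw i t.
  have [y0 dy] := PP y i cy; have [w0 dw] := PP w i cw.
  have -> : step y i t - step w i t = (P y i - P w i) (Num.max t 0).
    by rewrite /step !fctE; ring.
  apply: (growth _ (fun s =>
    truncated_rhs y i (Num.max s 0) - truncated_rhs w i (Num.max s 0))) => //.
  - by rewrite !fctE y0 w0 subrr.
  - move=> s s0; rewrite -mulrA; apply: truncated_rhs_lipschitz => [j|].
      by apply: le_trans (yw _ _) _; rewrite /E !(max_idPl s0).
    (* The weight is nondecreasing, so delayed differences obey the bound at the present time. *)
    apply: le_trans (yw _ _) _; rewrite ler_wpM2l// /E ler_expR ler_pM2l//.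
    by rewrite (max_l s0) ge_max s0 andbT; have := delay_gt0 i; lra.
  - by rewrite le_max lexx orbT.
pose Y n : 'I_m -> R -> R := iter n step (fun=> cst 1).
have cY n i : continuous (Y n i).
  elim: n i => [|n IH] i; first exact: cst_continuous.
  exact: cstep.
have Y1 i t : `|Y 1%N i t - Y 0%N i t| <= 1 / 2 * E t.
  rewrite /Y /= /step addrAC subrr add0r.
  have [P0 dP] := PP (fun=> cst 1) i (cY 0%N).
  apply: (growth _ _ 1 _ _ (fun s _ => dP s)) => //; last by rewrite le_max lexx orbT.
  move=> s s0; rewrite mulr1 (max_l s0).
  (* The first increment is bounded through the Lipschitz estimate between the constant functions 1
     and 0. *)
  have z0 : truncated_rhs (fun=> cst 0) i s = 0.
    rewrite /truncated_rhs /cst maxxx !(mulr0, mul0r) addr0 add0r big1// => j _.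
    by rewrite mulr0.
  rewrite -[truncated_rhs _ i s]subr0 -z0.
  apply: (@le_trans _ _ (lip * 1)).
    by apply: truncated_rhs_lipschitz => [j|]; rewrite /cst subr0 normr1.
  by rewrite ler_pM2l// -expR0 ler_expR mulr_ge0// ltW.
pose h (n : nat) : R := (1 / 2) ^+ n.
have hS n : h n.+1 = h n / 2 by rewrite /h exprSr mul1r.
have h0 n : 0 < h n by rewrite /h exprn_gt0//; lra.
have YS n i t : `|Y n.+1 i t - Y n i t| <= h n.+1 * E t.
  elim: n i t => [|n IH] i t; first by rewrite /h expr1; exact: Y1.
  by rewrite hS; apply: (contract (Y n.+1) (Y n)) => //; exact: ltW.
have E0 t : 0 < E t by exact: expR_gt0.
have Yk n k i t : `|Y (n + k)%N i t - Y n i t| <= (h n - h (n + k)%N) * E t.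
  elim: k => [|k IH]; first by rewrite addn0 !subrr mul0r normr0.
  rewrite addnS.
  have -> : Y (n + k).+1 i t - Y n i t =
    (Y (n + k).+1 i t - Y (n + k)%N i t) + (Y (n + k)%N i t - Y n i t) by ring.
  apply: le_trans (ler_normD _ _) _; apply: le_trans (lerD (YS _ _ _) IH) _.
  rewrite -mulrDl ler_pM2r// hS; lra.
have Ycauchy n0 n k i t : (n0 <= n)%N -> (n0 <= k)%N -> `|Y n i t - Y k i t| <= h n0 * E t.
  have hle a b : (a <= b)%N -> h b <= h a.
    move=> ab; rewrite /h; apply: ler_wiXn2l => //; lra.
  wlog nk : n k / (n <= k)%N => [H nn kk|nn kk].
    have [nk|/ltnW kn] := leqP n k; first exact: H.
    by rewrite distrC; exact: H.
  rewrite distrC -(subnKC nk); apply: le_trans (Yk _ _ _ _) _; rewrite ler_pM2r//.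
  by have := h0 (n + (k - n))%N; have := hle _ _ nn; lra.
have hsmall e : 0 < e -> exists n, h n <= e.
  move=> e0; exists (Num.truncn e^-1).+1.
  have : (Num.truncn e^-1).+1%:R <= 2 ^+ (Num.truncn e^-1).+1 :> R.
    by rewrite -natrX ler_nat ltnW// ltn_expl.
  have := truncnS_gt e^-1; rewrite /h => h1 h2.
  rewrite div1r exprVn -[leRHS]invrK lef_pV2 ?posrE ?exprn_gt0 ?invr_gt0//; lra.
have /choice [z zP] (it : 'I_m * R) : exists l, forall e n0,
    (forall n k, (n0 <= n)%N -> (n0 <= k)%N ->
     `|Y n it.1 it.2 - Y k it.1 it.2| <= e) ->
    forall n, (n0 <= n)%N -> `|Y n it.1 it.2 - l| <= e.
  apply: cauchy_limit => e e0.
  have [n0 Hn0] := hsmall (e / E it.2) (divr_gt0 e0 (E0 _)).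
  exists n0 => n k nn nk; apply: le_trans (Ycauchy _ _ _ _ _ nn nk) _.
  by rewrite -ler_pdivlMr.
pose y i t := z (i, t).
have Yy n i t : `|Y n i t - y i t| <= h n * E t.
  by apply: (zP (i, t) _ n) => // a b na nb; exact: Ycauchy.
have cy i : continuous (y i).
  move=> t; apply/continuousP_eps => e e0.
  pose b := expR (lam * (Num.max t 0 + 1)).
  have b0 : 0 < b by exact: expR_gt0.
  have e4 : 0 < e / 4 / b by rewrite !divr_gt0.
  have [n Hn] := hsmall _ e4.
  have e2 : 0 < e / 2 by lra.
  have /continuousP_eps /(_ _ e2) [d d0 Hd] := cY n i t.
  have Eb s : `|s - t| < 1 -> h n * E s <= e / 4.
    move=> st; rewrite ler_pdivlMr// in Hn; apply: le_trans Hn.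
    rewrite ler_pM2l// /E /b ler_expR ler_pM2l//.
    have := le_lt_trans (dist_max0_le s t) st.
    by rewrite ltr_norml => /andP[_]; lra.
  exists (Num.min d 1) => [|s]; first by rewrite lt_min d0 ltr01.
  rewrite lt_min => /andP[sd s1].
  have a1 := le_trans (Yy n i s) (Eb s s1).
  have a2 : `|Y n i t - y i t| <= e / 4.
    by apply: le_trans (Yy n i t) (Eb t _); rewrite subrr normr0.
  have -> : y i s - y i t = (Y n i s - Y n i t) -
    ((Y n i s - y i s) - (Y n i t - y i t)) by ring.
  apply: le_lt_trans (ler_normB _ _) _; have := Hd s sd.
  have := ler_normB (Y n i s - y i s) (Y n i t - y i t); lra.
have fixpt i t : y i t = step y i t.
  apply/eqP; rewrite -subr_eq0 -normr_le0 leNgt; apply/negP => pos.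
  set d := `|_| in pos.
  have d4 : 0 < d / 4 / E t by rewrite !divr_gt0.
  have [n Hn] := hsmall _ d4; rewrite ler_pdivlMr// in Hn.
  have a1 := contract (Y n) y (h n) (ltW (h0 n)) (cY n) cy (Yy n) i t.
  have a2 := Yy n.+1 i t.
  have dle : d <= `|step (Y n) i t - step y i t| + `|Y n.+1 i t - y i t|.
    rewrite /d /Y /= -/(Y n).
    have -> : y i t - step y i t =
      (step (Y n) i t - step y i t) - (step (Y n) i t - y i t) by ring.
    exact: ler_normB.
  rewrite hS in a2; lra.
exists y, (P y); split => // i; first by case: (PP y i cy).
by case: (PP y i cy).
Qed.

(** The truncated solution stays above [1 / 2 * exp (- (B + 1) * t)]: at a contact, coupling and
    feedback are nonnegative and damping is at most [B * y], less than the barrier's rate of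
    descent. Hence the truncation is inactive and the true equation holds. *)
Lemma solution_exists : exists y, solution_from N (fun=> cst 1) y.
Proof.
have [y [P [cy P0 dP yP]]] := truncated_solution_exists.
pose x i t : R := 1 + P i t.
have yx i t : 0 <= t -> y i t = x i t by move=> t0; rewrite yP max_l.
have dx i (t : R) : 0 <= t -> is_derive t 1 (x i) (truncated_rhs y i t).
  move=> t0; have := dP i t; rewrite (max_l t0) => D.
  have : is_derive t 1 (cst 1 + P i) (0 + truncated_rhs y i t) by apply: is_deriveD.
  by rewrite add0r.
pose k : R := B + 1.
pose E t : R := - (1 / 2 * expR (- k * t)).
have dE (t : R) : is_derive t 1 E (k / 2 * expR (- k * t)).
  have -> : E = - (1 / 2) \*: (expR \o (- k \*: id)).
    by apply/funext => u; rewrite /E -mulNr.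
  have D : is_derive t 1 (expR \o (- k \*: id)) (expR (- k * t) * (- k *: 1)).
    by apply: is_derive1_comp.
  apply: is_derive_eq; have sE (a b : R) : a *: b = a * b by [].
  by rewrite !sE; field.
have xE i t : 0 <= t -> - x i t < E t.
  apply: (@first_contact R _ (fun i t => - x i t) (fun i t => - truncated_rhs y i t) E
    (fun t => k / 2 * expR (- k * t)) 0).
  - by move=> j s s0; have := dx j s s0 => ?; exact: is_deriveN.
  - by move=> j; rewrite /E /x P0 mulr0 expR0; lra.
  move=> j s s0 below xs.
  have y0 l : 0 <= y l s.
    rewrite yx ?ltW//; have := below l s; rewrite lexx (ltW s0) => /(_ isT).
    by rewrite /E; have := expR_gt0 (- k * s); lra.
  have ys : y j s = 1 / 2 * expR (- k * s).
    by rewrite yx ?ltW//; move: xs; rewrite /E; lra.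
  rewrite /truncated_rhs; set S := \sum_(l < m) _; set F := bcoef N j s * _.
  have S0 : 0 <= S by apply: sumr_ge0 => l _; rewrite mulr_ge0.
  have F0 : 0 <= F.
    by rewrite /F !mulr_ge0 ?expR_ge0 ?le_max ?lexx ?orbT// ltW.
  have dB : dcoef N j s <= B by exact: le_trans (ler_norm _) (dcoef_le j s).
  have dy : dcoef N j s * y j s <= B * y j s by rewrite ler_wpM2r.
  have -> : k / 2 * expR (- k * s) = B * y j s + y j s by rewrite ys /k; field.
  have : 0 < y j s by rewrite ys; have := expR_gt0 (- k * s); lra.
  lra.
have ypos i t : 0 < y i t.
  rewrite yP; have := xE i (Num.max t 0); rewrite le_max lexx orbT => /(_ isT).
  by rewrite /E /x; have := expR_gt0 (- k * Num.max t 0); lra.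
have rhsE i t : truncated_rhs y i t = nicholson_rhs N y i t.
  by rewrite /truncated_rhs /nicholson_rhs (max_l (ltW (ypos _ _))) mulrA.
have y1 i t : t <= 0 -> y i t = 1 by move=> t0; rewrite yP max_r// P0 addr0.
exists y; split.
- by move=> i; apply: continuous_subspaceT; exact: cy.
- by move=> i s /andP[_ s0]; rewrite y1.
- move=> i; rewrite -rhsE.
  have := is_derive_at_right (dx i 0 (lexx 0)); apply: cvg_trans; apply: near_eq_cvg.
  near=> h; have h0 : 0 <= h by apply: ltW; near: h; exact: nbhs_right_gt.
  by rewrite add0r !yx.
- move=> i t t0; rewrite -rhsE; apply: near_eq_is_derive (dx i t (ltW t0)).
  by near=> s; rewrite yx//; apply: ltW; near: s; exact: lt_nbhsr.
Unshelve. all: by end_near. Qed.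

End NicholsonDynamics.

Theorem theorem3p6 (R : realType) (m : nat) (N : nicholson R m)
  (hr : forall i, 0 < delay N i)
  (a1d : forall i, almost_periodic (dcoef N i))
  (a1a : forall i j, almost_periodic (acoef N i j))
  (a1c : forall i, almost_periodic (ccoef N i))
  (a1b : forall i, almost_periodic (bcoef N i))
  (a2 : exists2 d0 : R, 0 < d0 & forall t i, d0 <= dcoef N i t)
  (a3 : (forall i j t, 0 <= acoef N i j t) /\ (forall i t, acoef N i i t = 0))
  (a4 : forall t i, 0 < bcoef N i t)
  (a5 : exists2 c0 : R, 0 < c0 & forall t i, c0 <= ccoef N i t)
  (a6 : forall t i, 0 < dcoef N i t - \sum_(j < m) acoef N j i t)
  (hpers : uniformly_persistent N)
  (hcond : forall t i,
    0 < bcoef N i t /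
        (dcoef N i t
         - \sum_(j < m | j != i) acoef N i j t * (csup N i / csup N j))
      <= expR (cinf N i / csup N i)) :
  exists p : 'I_m -> R -> R,
    unique (positive_ap_solution N) p /\
    forall phi y : 'I_m -> R -> R,
      in_state_space N phi -> state_ge0 N phi -> (forall i, 0 < phi i 0) ->
      solution_from N phi y -> attracts_exponentially N p y.
Proof.
have [acoef_ge0 acoef_diag] := a3; have [c0 c0_gt0 ccoef_ge] := a5.
have apN k : almost_periodic (coef N k) by case: k => [[i j]|[i|[i|i]]] /=.
have [B B_gt0 coef_le] := almost_periodic_family_bounded apN.
have bcoef_le t i : bcoef N i t <= expR (cinf N i / csup N i) * dominance N t i.
  rewrite /dominance (bigD1 i)//= acoef_diag mul0r add0r.
  (* Positivity of the quotient and of [bcoef] forces a positive denominator, which may then be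
     multiplied out. *)
  have /andP[] := hcond t i; rewrite pmulr_rgt0// invr_gt0 => dom_gt0.
  by rewrite ler_pdivrMr.
have [M M_gt0 persistent] := hpers.
(* Any single solution generates the almost periodic one; the one starting from the constant 1 is
   taken. *)
have [y sol_y] := solution_exists hr apN B_gt0 coef_le acoef_ge0 a4 c0_gt0 ccoef_ge.
have [|||T0 /(_ T0 (lexx _)) [_ y_region dy]] :=
  solution_eventually_in_region hr apN B_gt0 coef_le
  acoef_ge0 a4 c0_gt0 ccoef_ge bcoef_le persistent _ _ _ sol_y.
- by move=> i; apply: continuous_subspaceT; exact: cst_continuous.
- by move=> i s _; exact: ler01.
- by move=> i; exact: ltr01.
have [p pP] := ap_solution_exists hr apN B_gt0 coef_le acoef_ge0 a4 c0_gt0 ccoef_ge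
   M_gt0 y_region dy.
exists p; split.
  split=> // q; exact: (ap_solution_unique hr apN B_gt0 coef_le acoef_ge0 a4 c0_gt0
    ccoef_ge bcoef_le M_gt0 persistent pP).
move=> phi z phic phi_ge0 phi_gt0 sol_z.
have [p_c p_ge0 p_gt0 sol_p] := ap_solution_from pP.
exact: (solutions_attract_exponentially hr apN B_gt0 coef_le acoef_ge0 a4 c0_gt0
    ccoef_ge bcoef_le M_gt0 persistent phic phi_ge0 phi_gt0 sol_z
    p_c p_ge0 p_gt0 sol_p).
Qed.
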